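(* Let $K_1$ be the virtual trefoil knot, i.e. the closure of the virtual braid $\sigma_1^{-2}\rho_1\in VB_2$, and let $G(K_1)=G_A(K_1)$ be its group. Then: (1) $G(K_1)/\gamma_4G(K_1)\cong F_2/\gamma_4F_2$, $\ \gamma_4G(K_1)/\gamma_5G(K_1)\cong\mathbb{Z}^2$, and $G(K_1)/\gamma_5G(K_1)\not\cong F_2/\gamma_5F_2$, where $F_2$ is the free group of rank 2. (2) The group $G(K_1)$ is an extension of a free group of rank 3 by an infinite cyclic group, i.e. it has a normal subgroup that is free of rank 3 with infinite cyclic quotient.
   Context: Conjugation: $x^{y}=y^{-1}xy$. Lower central series: $\gamma_1(G)=G$, $\gamma_{i+1}(G)=[\gamma_i(G),G]$. $VB_2$ is generated by $\sigma_1,\rho_1$ with the relation $\rho_1^2=1$. The representation $\varphi_A:VB_2\to\operatorname{Aut}(\langle x_1,x_2,y\rangle)$ (automorphisms of the free group of rank 3) is: $\varphi_A(\sigma_1): x_1\mapsto x_1x_2x_1^{-1},\ x_2\mapsto x_1,\ y\mapsto y$; $\varphi_A(\rho_1): x_1\mapsto x_2^{y^{-1}},\ x_2\mapsto x_1^{y},\ y\mapsto y$. Automorphisms act on the right (in a braid word the automorphism of the leftmost letter is applied first). For a virtual link $K$ that is the closure of $\beta\in VB_2$, $G_A(K)=\langle x_1,x_2,y\mid x_i=\varphi_A(\beta)(x_i),\ i=1,2\rangle$. Explicitly, for $\beta=\sigma_1^{-2}\rho_1$, $$G(K_1)=\langle x_1,x_2,y\mid x_1=y^{-1}x_1^{-1}y^2x_2y^{-2}x_1y,\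 \ x_2=y^{-1}x_1^{-1}y^2x_2^{-1}y^{-2}x_1y\cdot yx_2y^{-2}x_1y\rangle.$$ *)

(* Defs.v *)
From HB Require Import structures.
From mathcomp Require Import all_boot all_order all_algebra generic_quotient.
From mathcomp Require Import boolp classical_sets.

Set Implicit Arguments.
Unset Strict Implicit.
Unset Printing Implicit Defensive.

Local Open Scope classical_set_scope.
Local Open Scope quotient_scope.
Local Open Scope group_scope.

Definition isomorphic (G H : groupType) : Prop :=
  exists f : {multiplicative G -> H}, bijective f.

Definition normal_set (G : groupType) (N : set G) : Prop :=
  forall x y, N x -> N (x ^ y).

Record subgroup (G : groupType) := Subgroup {
  sgset :> set G;
  subgroup_closed : group_closed (mem sgset) }.

Record nsubgroup (G : groupType) := NSubgroup {
  nsubgroup_subgroup :> subgroup G;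
  nsubgroup_normal : normal_set nsubgroup_subgroup }.

Section SubgroupTheory.
Variables (G : groupType) (H : subgroup G).

Lemma sg1 : sgset H 1.
Proof. by have [/set_mem] := subgroup_closed H. Qed.

Lemma sgV x : sgset H x -> sgset H x^-1.
Proof.
by move=> /mem_set Hx; apply/set_mem; apply: group_closedV (subgroup_closed H) _ Hx.
Qed.

Lemma sgM x y : sgset H x -> sgset H y -> sgset H (x * y).
Proof.
move=> /mem_set Hx /mem_set Hy; apply/set_mem.
exact: group_closedM (subgroup_closed H) _ _ Hx Hy.
Qed.

Lemma group_closedI (A : set G) : A 1 ->
  (forall x y, A x -> A y -> A (x / y)) -> group_closed (mem A).
Proof.
move=> A1 AF; split; first exact/mem_set.
by move=> x y /set_mem Ax /set_mem Ay; apply/mem_set/AF.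
Qed.

Definition sgtype : Type := {x : G | x \in sgset H}.
HB.instance Definition _ := SubChoice.on sgtype.
HB.instance Definition _ :=
  SubChoice_isSubGroup.Build G _ sgtype (subgroup_closed H).

End SubgroupTheory.

Lemma sgJ (G : groupType) (N : nsubgroup G) x y :
  sgset N x -> sgset N (x ^ y).
Proof. exact: nsubgroup_normal. Qed.

Section Quotient.
Variables (G : groupType) (N : nsubgroup G).

Definition cosetrel (x y : G) : bool := x^-1 * y \in sgset N.

Lemma cosetrelE x y : cosetrel x y = sgset N (x^-1 * y) :> Prop.
Proof. by rewrite /cosetrel inE. Qed.

Lemma cosetrel_refl : reflexive cosetrel.
Proof. by move=> x; rewrite /cosetrel mulVg; apply/mem_set/sg1. Qed.

Lemma cosetrel_sym : symmetric cosetrel.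
Proof.
suff h x y : cosetrel x y -> cosetrel y x by move=> x y; apply/idP/idP => /h.
by rewrite !cosetrelE => /sgV; rewrite invgM invgK.
Qed.

Lemma cosetrel_trans : transitive cosetrel.
Proof.
move=> y x z; rewrite !cosetrelE => Nxy Nyz.
by have := sgM Nxy Nyz; rewrite -!mulgA mulVKg.
Qed.

Canonical cosetrel_equiv :=
  EquivRel cosetrel cosetrel_refl cosetrel_sym cosetrel_trans.

Definition quot : Type := {eq_quot cosetrel}.
HB.instance Definition _ := Choice.on quot.
HB.instance Definition _ := EqQuotient.on quot.

Definition qproj (x : G) : quot := \pi_quot x.

Lemma qproj_repr (u : quot) : qproj (repr u) = u.
Proof. exact: reprK. Qed.

Lemma qproj_eq x y : qproj x = qproj y <-> sgset N (x^-1 * y).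
Proof.
rewrite -cosetrelE; split; last by move=> h; apply/eqP; rewrite piE.
by move=> /eqP; rewrite piE.
Qed.

Lemma repr_qproj x : sgset N (x^-1 * repr (qproj x)).
Proof. by apply/qproj_eq; rewrite qproj_repr. Qed.

Definition qone : quot := qproj 1.
Definition qinv (u : quot) : quot := qproj (repr u)^-1.
Definition qmul (u v : quot) : quot := qproj (repr u * repr v).

Lemma qinvE x : qinv (qproj x) = qproj x^-1.
Proof.
apply/qproj_eq; rewrite invgK.
have := sgJ x^-1 (repr_qproj x).
by rewrite conjgE invgK -mulgA mulVKg.
Qed.

Lemma qmulE x y : qmul (qproj x) (qproj y) = qproj (x * y).
Proof.
apply/esym/qproj_eq; set x' := repr _; set y' := repr _.
have -> : (x * y)^-1 * (x' * y') = (x^-1 * x') ^ y * (y^-1 * y').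
  by rewrite conjgE invgM -!mulgA mulVKg.
exact: sgM (sgJ y (repr_qproj x)) (repr_qproj y).
Qed.

Lemma qmulA : associative qmul.
Proof.
move=> u v w; rewrite -(qproj_repr u) -(qproj_repr v) -(qproj_repr w).
by rewrite !qmulE mulgA.
Qed.

Lemma qmul1 : left_id qone qmul.
Proof. by move=> u; rewrite -(qproj_repr u) qmulE mul1g. Qed.

Lemma qmulr1 : right_id qone qmul.
Proof. by move=> u; rewrite -(qproj_repr u) qmulE mulg1. Qed.

Lemma qmulV : left_inverse qone qinv qmul.
Proof. by move=> u; rewrite -(qproj_repr u) qinvE qmulE mulVg. Qed.

Lemma qmulrV : right_inverse qone qinv qmul.
Proof. by move=> u; rewrite -(qproj_repr u) qinvE qmulE mulgV. Qed.

HB.instance Definition _ :=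
  isGroup.Build quot qmulA qmul1 qmulr1 qmulV qmulrV.

Lemma qprojM : {morph qproj : x y / x * y}.
Proof. by move=> x y; rewrite -qmulE. Qed.

HB.instance Definition _ := isMultiplicative.Build G quot qproj qprojM.
HB.instance Definition _ :=
  Multiplicative_isUMagmaMorphism.Build G quot qproj erefl.

Lemma qproj_eq1 x : qproj x = 1 <-> sgset N x.
Proof.
split=> [/esym/qproj_eq|Nx]; first by rewrite invg1 mul1g.
by apply/esym/qproj_eq; rewrite invg1 mul1g.
Qed.

End Quotient.

(* The intersection of N and H, as a normal subgroup of H *)
Section Restrict.
Variables (G : groupType) (H : subgroup G) (N : nsubgroup G).

Let restrict_set : set (sgtype H) := [set u | sgset N (val u)].

Lemma restrict_closed : group_closed (mem restrict_set).
Proof.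
apply: group_closedI; first by rewrite /restrict_set /mkset val1; apply: sg1.
move=> x y Nx Ny; rewrite /restrict_set /mkset gmulfF; exact: sgM (sgV _).
Qed.

Lemma restrict_normal : normal_set (Subgroup restrict_closed).
Proof.
by move=> x y Nx; rewrite /sgset /restrict_set /mkset gmulfJ; apply: nsubgroup_normal.
Qed.

Definition restrict : nsubgroup (sgtype H) := NSubgroup restrict_normal.

End Restrict.

Section Generated.
Variable G : groupType.
Implicit Types A H K : set G.

Definition generated A : set G := smallest (fun H => group_closed (mem H)) A.

Lemma generated_closed A : group_closed (mem (generated A)).
Proof.
apply: group_closedI; first by move=> H [[/set_mem]].
move=> x y gx gy H hH; have hx := gx H hH; have hy := gy H hH.
apply/set_mem; apply: hH.1.2; exact/mem_set.
Qed.

Lemma generated_normal A : normal_set A -> normal_set (generated A).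
Proof.
move=> nA x y gx H hH.
apply: (gx (fun z => H (z ^ y))); split; last by move=> z Az; apply: hH.2; apply: nA.
pose HS := Subgroup hH.1.
apply: group_closedI => [|u v Hu Hv]; first by rewrite conj1g; apply: (sg1 HS).
by rewrite conjMg conjVg; exact: (@sgM _ HS _ _ Hu (@sgV _ HS _ Hv)).
Qed.

Definition normal_closure_set A : set G :=
  smallest (fun H => group_closed (mem H) /\ normal_set H) A.

Lemma normal_closure_closed A : group_closed (mem (normal_closure_set A)).
Proof.
apply: group_closedI; first by move=> H [[[/set_mem]]].
move=> x y gx gy H hH; have hx := gx H hH; have hy := gy H hH.
apply/set_mem; apply: hH.1.1.2; exact/mem_set.
Qed.

Lemma normal_closure_normal A :
  normal_set (Subgroup (@normal_closure_closed A)).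
Proof. by move=> x y gx H hH; apply: hH.1.2; apply: gx. Qed.

Definition normal_closure A : nsubgroup G := NSubgroup (@normal_closure_normal A).

Definition commutator_set H K : set G :=
  generated [set [~ x, y] | x in H & y in K].

Lemma commutator_normal H K :
  normal_set H -> normal_set K -> normal_set (commutator_set H K).
Proof.
move=> nH nK; apply: generated_normal => _ z [x Hx [y Ky <-]].
by rewrite conjRg; exists (x ^ z); [exact: nH|exists (y ^ z); first exact: nK].
Qed.

Definition commutator_subgroup H K : subgroup G :=
  Subgroup (generated_closed [set [~ x, y] | x in H & y in K]).

Lemma setT_closed : group_closed (mem [set: G]).
Proof. exact: group_closedI. Qed.

Lemma setT_normal : normal_set (Subgroup setT_closed).
Proof. by []. Qed.

Definition commutator_nsubgroup (H K : nsubgroup G) : nsubgroup G :=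
  @NSubgroup G (commutator_subgroup H K)
    (commutator_normal (@nsubgroup_normal _ H) (@nsubgroup_normal _ K)).

Definition whole_group : nsubgroup G := NSubgroup setT_normal.

(* The series starts at index 1; lcs 0 is also the whole group. *)
Fixpoint lcs (n : nat) : nsubgroup G :=
  if n is (m.+1 as n').+1 then commutator_nsubgroup (lcs n') whole_group
  else whole_group.

End Generated.

(* This is gamma_m(G) / gamma_n(G) only for m <= n. *)
Definition lcs_factor (G : groupType) (m n : nat) : groupType :=
  quot (restrict (lcs G m) (lcs G n)).

(* Elements of a free group are reduced words; the letter (i, true) is the
   i-th generator and (i, false) its inverse. *)

Section FreeGroup.
Variable I : choiceType.
Notation letter := (I * bool)%type.
Implicit Types (a : letter) (r s u v w : seq letter).

Definition linv a : letter := (a.1, ~~ a.2).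

Lemma linvK : involutive linv.
Proof. by case=> i b; rewrite /linv /= negbK. Qed.

Definition reduced w : bool := sorted (fun a b => b != linv a) w.

Definition fcons a s : seq letter :=
  if s is b :: s' then if b == linv a then s' else a :: s else [:: a].

Definition fapp u v : seq letter := foldr fcons v u.

Lemma fcons_reduced a s : reduced s -> reduced (fcons a s).
Proof.
case: s => [//|b s] /= rs; case: ifPn => [_|nb]; first exact: path_sorted rs.
by rewrite /reduced /= nb.
Qed.

Lemma fapp_reduced u v : reduced v -> reduced (fapp u v).
Proof. by move=> rv; elim: u => //= a u; apply: fcons_reduced. Qed.

Lemma fconsK a s : reduced s -> fcons (linv a) (fcons a s) = s.
Proof.
case: s => [_|b s]; first by rewrite /= linvK eqxx.
rewrite /reduced /=; case: eqVneq => [->|_] rs; last by rewrite /= linvK eqxx.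
by case: s rs => [//|c s] /= /andP[/negPf-> _].
Qed.

Lemma fapp_fcons a s r : reduced r -> fapp (fcons a s) r = fcons a (fapp s r).
Proof.
case: s => [//|b s] rr /=; case: eqVneq => [->|//].
by have := fconsK (linv a) (fapp_reduced s rr); rewrite linvK => ->.
Qed.

Lemma fappA u v w : reduced w -> fapp (fapp u v) w = fapp u (fapp v w).
Proof. by move=> rw; elim: u => //= a u IHu; rewrite fapp_fcons // IHu. Qed.

Lemma fapps0 u : reduced u -> fapp u [::] = u.
Proof.
elim: u => //= a u IHu ru; rewrite IHu; last exact: path_sorted ru.
by case: u ru {IHu} => //= b u /andP[/negPf-> _].
Qed.

Definition winv w : seq letter := rev (map linv w).

Lemma winvK : involutive winv.
Proof. by move=> w; rewrite /winv map_rev revK mapK //; exact: linvK. Qed.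

Lemma winv_reduced w : reduced w -> reduced (winv w).
Proof.
rewrite /reduced /winv rev_sorted sorted_map => rw; apply: sub_sorted rw.
by move=> a b; apply: contra => /= /eqP ->; rewrite linvK.
Qed.

Lemma fappK u r : reduced r -> fapp (winv u) (fapp u r) = r.
Proof.
elim: u r => //= a u IHu r rr; rewrite /winv /= rev_cons /fapp foldr_rcons.
by rewrite fconsK ?fapp_reduced //; exact: IHu.
Qed.

Definition Free : Type := {w : seq letter | reduced w}.
HB.instance Definition _ := SubChoice.on Free.

Definition fone : Free := exist _ [::] isT.
Definition fmul (x y : Free) : Free :=
  exist _ (fapp (val x) (val y)) (fapp_reduced (val x) (valP y)).
Definition finv (x : Free) : Free :=
  exist _ (winv (val x)) (winv_reduced (valP x)).

Lemma fmulA : associative fmul.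
Proof. by move=> x y z; apply/val_inj; rewrite /= fappA //; exact: valP. Qed.

Lemma fmul1 : left_id fone fmul.
Proof. by move=> x; apply/val_inj. Qed.

Lemma fmulr1 : right_id fone fmul.
Proof. by move=> x; apply/val_inj; rewrite /= fapps0 //; exact: valP. Qed.

Lemma fmulV : left_inverse fone finv fmul.
Proof.
move=> x; apply/val_inj => /=.
by rewrite -[X in fapp _ X](fapps0 (valP x)) fappK.
Qed.

Lemma fmulrV : right_inverse fone finv fmul.
Proof.
by move=> x; have := fmulV (finv x); congr (fmul _ _ = _); apply/val_inj/winvK.
Qed.

HB.instance Definition _ :=
  isGroup.Build Free fmulA fmul1 fmulr1 fmulV fmulrV.

Definition fgen (i : I) : Free := exist _ [:: (i, true)] isT.

Section Lift.
Variables (H : groupType) (f : I -> H).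

Definition lletter a : H := if a.2 then f a.1 else (f a.1)^-1.

Definition flift (x : Free) : H := \prod_(a <- val x) lletter a.

Lemma lletterV a : lletter (linv a) = (lletter a)^-1.
Proof. by case: a => i [] //; rewrite /lletter /= invgK. Qed.

Lemma prod_fcons a s :
  \prod_(b <- fcons a s) lletter b = lletter a * \prod_(b <- s) lletter b.
Proof.
case: s => [|b s] /=; first by rewrite big_seq1 big_nil mulg1.
case: eqP => [->|_]; last by rewrite big_cons.
by rewrite big_cons lletterV mulVKg.
Qed.

Lemma fliftM : {morph flift : x y / x * y}.
Proof.
move=> x y; rewrite /flift /=.
elim: (val x) => [|a u IHu] /=; first by rewrite big_nil mul1g.
by rewrite prod_fcons IHu big_cons mulgA.
Qed.

Lemma flift1 : flift 1 = 1.
Proof. exact: big_nil. Qed.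

HB.instance Definition _ := isMultiplicative.Build Free H flift fliftM.
HB.instance Definition _ :=
  Multiplicative_isUMagmaMorphism.Build Free H flift flift1.

Lemma flift_gen i : flift (fgen i) = f i.
Proof. exact: big_seq1. Qed.

End Lift.

Lemma flift_fgen (x : Free) : flift fgen x = x.
Proof.
apply/val_inj; rewrite /flift -[RHS](fapps0 (valP x)).
elim: (val x) => [|a u IHu]; first by rewrite big_nil.
by rewrite big_cons /= -IHu; case: a => i [].
Qed.

Lemma flift_uniq (H : groupType) (f : I -> H) (g : {multiplicative Free -> H}) :
  (forall i, g (fgen i) = f i) -> g =1 flift f.
Proof.
move=> gf x; have g1 : g 1 = 1 by apply: (@mulgI _ (g 1)); rewrite -gmulfM !mulg1.
have gV y : g y^-1 = (g y)^-1.
  by apply: (@mulgI _ (g y)); rewrite -gmulfM !mulgV.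
rewrite -[in LHS](flift_fgen x) /flift (big_morph g (@gmulfM _ _ g) g1).
by apply: eq_bigr => -[i []] _; rewrite /lletter /= ?gV gf.
Qed.

End FreeGroup.

Definition presented (I : choiceType) (R : set (Free I)) : groupType :=
  quot (normal_closure R).

Definition pgen (I : choiceType) (R : set (Free I)) (i : I) : presented R :=
  qproj (normal_closure R) (fgen i).

(* The map induced by f, a morphism as soon as f maps the relators to 1 *)
Definition plift (I : choiceType) (R : set (Free I)) (H : groupType)
  (f : I -> H) (u : presented R) : H := flift f (repr (u : quot _)).

Lemma flift_ker (I : choiceType) (R : set (Free I)) (H : groupType)
    (f : I -> H) : (forall r, R r -> flift f r = 1) ->
  forall x, sgset (normal_closure R) x -> flift f x = 1.
Proof.
move=> fR x Nx; apply: (Nx (fun z => flift f z = 1)); split=> //; split.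
  apply: group_closedI => [|y z /= fy fz]; first exact: gmulf1.
  by rewrite gmulfF /= fy fz divgg.
by move=> y z /= fy; rewrite gmulfJ /= fy conj1g.
Qed.

Lemma plift_proj (I : choiceType) (R : set (Free I)) (H : groupType)
    (f : I -> H) : (forall r, R r -> flift f r = 1) ->
  forall x, plift f (qproj (normal_closure R) x) = flift f x.
Proof.
move=> fR x; have /(flift_ker fR) := repr_qproj (normal_closure R) x.
by rewrite gmulfM gmulfV => /mulg1_eq; rewrite invgK.
Qed.

Lemma pliftM (I : choiceType) (R : set (Free I)) (H : groupType)
    (f : I -> H) : (forall r, R r -> flift f r = 1) ->
  {morph @plift I R H f : u v / u * v}.
Proof.
move=> fR u v; rewrite -(qproj_repr u) -(qproj_repr v).
by rewrite -gmulfM !plift_proj // gmulfM.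
Qed.

(* Automorphisms act on the right: f * g applies f first. *)

Section Aut.
Variable G : groupType.

Definition is_aut (f : G -> G) : Prop :=
  {morph f : x y / x * y} /\ bijective f.

Definition Aut : Type := {f : G -> G | `[< is_aut f >]}.
HB.instance Definition _ := SubChoice.on Aut.

Definition aut_fun (f : Aut) : G -> G := val f.
Coercion aut_fun : Aut >-> Funclass.

Lemma autP (f : Aut) : is_aut f.
Proof. exact/asboolP/(valP f). Qed.

Definition mkAut (f : G -> G) (hf : is_aut f) : Aut := exist _ f (asboolT hf).

Lemma aut_eq (f g : Aut) : f =1 g -> f = g.
Proof. by move=> fg; apply/val_inj/funext. Qed.

Lemma is_aut_id : is_aut id.
Proof. by split=> //; exists id. Qed.

Lemma is_aut_comp (f g : Aut) : is_aut (g \o f).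
Proof.
have [[fM fB] [gM gB]] := (autP f, autP g).
by split; [move=> x y /=; rewrite fM gM|exact: bij_comp].
Qed.

Lemma aut_inv_ex (f : Aut) : exists g : G -> G, cancel f g /\ cancel g f.
Proof. by have [_ [g fg gf]] := autP f; exists g. Qed.

Definition aut_inv_fun (f : Aut) : G -> G := projT1 (cid (aut_inv_ex f)).

Lemma aut_funK (f : Aut) : cancel f (aut_inv_fun f).
Proof. by rewrite /aut_inv_fun; case: cid => g []. Qed.

Lemma aut_funVK (f : Aut) : cancel (aut_inv_fun f) f.
Proof. by rewrite /aut_inv_fun; case: cid => g []. Qed.

Lemma is_aut_inv (f : Aut) : is_aut (aut_inv_fun f).
Proof.
split; last by exists f; [exact: aut_funVK|exact: aut_funK].
move=> x y; apply: (can_inj (aut_funK f)).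
by rewrite (autP f).1 !aut_funVK.
Qed.

Definition aut_one : Aut := mkAut is_aut_id.
Definition aut_mul (f g : Aut) : Aut := mkAut (is_aut_comp f g).
Definition aut_inv (f : Aut) : Aut := mkAut (is_aut_inv f).

Lemma aut_mulA : associative aut_mul.
Proof. by move=> f g h; apply: aut_eq. Qed.

Lemma aut_mul1 : left_id aut_one aut_mul.
Proof. by move=> f; apply: aut_eq. Qed.

Lemma aut_mulr1 : right_id aut_one aut_mul.
Proof. by move=> f; apply: aut_eq. Qed.

Lemma aut_mulV : left_inverse aut_one aut_inv aut_mul.
Proof. by move=> f; apply: aut_eq; exact: aut_funVK. Qed.

Lemma aut_mulrV : right_inverse aut_one aut_inv aut_mul.
Proof. by move=> f; apply: aut_eq; exact: aut_funK. Qed.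

HB.instance Definition _ :=
  isGroup.Build Aut aut_mulA aut_mul1 aut_mulr1 aut_mulV aut_mulrV.

Lemma aut_mulE (f g : Aut) x : aut_fun (f * g) x = g (f x).
Proof. by []. Qed.

Lemma aut_invE (f g : Aut) : cancel f g -> f^-1 = g :> Aut.
Proof.
move=> fg; have fg1 : f * g = 1 :> Aut by apply: aut_eq.
exact: mulg1_eq fg1.
Qed.

End Aut.

(* sigma_1 is the generator of index 0, rho_1 the generator of index 1. *)
Definition VB2_relators : set (Free 'I_2) := [set fgen (@Ordinal 2 1 isT) ^+ 2].

Definition VB2 : groupType := presented VB2_relators.

Definition sigma1 : VB2 := pgen VB2_relators (@Ordinal 2 0 isT).
Definition rho1 : VB2 := pgen VB2_relators (@Ordinal 2 1 isT).

Definition F3 : groupType := Free 'I_3.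

Definition x1 : F3 := fgen (@Ordinal 3 0 isT).
Definition x2 : F3 := fgen (@Ordinal 3 1 isT).
Definition y : F3 := fgen (@Ordinal 3 2 isT).

Definition endo (a b c : F3) : F3 -> F3 := flift (tnth [tuple a; b; c]).
HB.instance Definition _ a b c := Multiplicative.copy (endo a b c)
  (flift (tnth [tuple a; b; c])).
HB.instance Definition _ a b c := UMagmaMorphism.copy (endo a b c)
  (flift (tnth [tuple a; b; c])).

Lemma endoM a b c u v : endo a b c (u * v) = endo a b c u * endo a b c v.
Proof. exact: fliftM. Qed.
Lemma endoV a b c u : endo a b c u^-1 = (endo a b c u)^-1.
Proof. exact: (@gmulfV _ _ (endo a b c)). Qed.
Lemma endo_x1 a b c : endo a b c x1 = a.
Proof. exact: flift_gen. Qed.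
Lemma endo_x2 a b c : endo a b c x2 = b.
Proof. exact: flift_gen. Qed.
Lemma endo_y a b c : endo a b c y = c.
Proof. exact: flift_gen. Qed.
Definition endoE := (endo_x1, endo_x2, endo_y, endoM, endoV).

Lemma F3_morph_id (f : {multiplicative F3 -> F3}) :
  f x1 = x1 -> f x2 = x2 -> f y = y -> f =1 id.
Proof.
move=> f1 f2 fy x; rewrite (@flift_uniq _ _ (@fgen 'I_3) f) ?flift_fgen //.
by case=> -[|[|[|//]]] lti; rewrite (bool_irrelevance lti isT).
Qed.

Lemma endo_aut a b c a' b' c' :
  cancel (endo a b c) (endo a' b' c') -> cancel (endo a' b' c') (endo a b c) ->
  is_aut (endo a b c).
Proof. by split; [exact: gmulfM|exists (endo a' b' c')]. Qed.

Lemma endo_can a b c a' b' c' :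
  endo a' b' c' a = x1 -> endo a' b' c' b = x2 -> endo a' b' c' c = y ->
  cancel (endo a b c) (endo a' b' c').
Proof.
move=> ea eb ec.
by apply: (@F3_morph_id (endo a' b' c' \o endo a b c)); rewrite /= endoE.
Qed.

Definition sigma1_endo := endo (x1 * x2 * x1^-1) x1 y.
Definition sigma1_endoV := endo x2 (x1 ^ x2) y.
Definition rho1_endo := endo (x2 ^ y^-1) (x1 ^ y) y.

Lemma sigma1_endoK : cancel sigma1_endo sigma1_endoV.
Proof.
by apply: endo_can; rewrite !endoE // conjgE !mulgA mulgV mul1g mulgK.
Qed.

Lemma sigma1_endoVK : cancel sigma1_endoV sigma1_endo.
Proof.
by apply: endo_can; rewrite ?conjgE !endoE // !mulgA mulVg mul1g mulgVK.
Qed.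

Lemma rho1_endoK : involutive rho1_endo.
Proof.
by apply: endo_can; rewrite ?conjgE !endoE // ?invgK !mulgA ?mulgV ?mulVg mul1g -mulgA ?mulgV ?mulVg mulg1.
Qed.

Lemma sigma1_aut : is_aut sigma1_endo.
Proof. exact: endo_aut sigma1_endoK sigma1_endoVK. Qed.

Lemma sigma1V_aut : is_aut sigma1_endoV.
Proof. exact: endo_aut sigma1_endoVK sigma1_endoK. Qed.

Lemma rho1_aut : is_aut rho1_endo.
Proof. exact: endo_aut rho1_endoK rho1_endoK. Qed.

Definition phiA_gen : 'I_2 -> Aut F3 :=
  tnth [tuple mkAut sigma1_aut; mkAut rho1_aut].

Definition phiA (b : VB2) : Aut F3 := plift phiA_gen b.

Lemma phiA_relators r : VB2_relators r -> flift phiA_gen r = 1.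
Proof.
move=> ->; rewrite gmulfXn /= flift_gen expgS expg1.
by apply: aut_eq => x; exact: rho1_endoK.
Qed.

Lemma phiAM : {morph phiA : b c / b * c}.
Proof. exact: pliftM phiA_relators. Qed.

HB.instance Definition _ := isMultiplicative.Build VB2 (Aut F3) phiA phiAM.

Lemma phiA1 : phiA 1 = 1.
Proof. by rewrite /phiA plift_proj ?gmulf1 //; exact: phiA_relators. Qed.

HB.instance Definition _ :=
  Multiplicative_isUMagmaMorphism.Build VB2 (Aut F3) phiA phiA1.

Lemma phiA_sigma1 : phiA sigma1 = mkAut sigma1_aut.
Proof.
by rewrite /phiA plift_proj ?flift_gen //; exact: phiA_relators.
Qed.

Lemma phiA_rho1 : phiA rho1 = mkAut rho1_aut.
Proof.
by rewrite /phiA plift_proj ?flift_gen //; exact: phiA_relators.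
Qed.

Lemma phiA_sigma1V : phiA sigma1^-1 = mkAut sigma1V_aut.
Proof.
rewrite gmulfV /= [phiA _]phiA_sigma1.
by apply: (@aut_invE _ (mkAut sigma1_aut) (mkAut sigma1V_aut)); exact: sigma1_endoK.
Qed.

(* A relation u = v is encoded by the relator u^-1 * v. *)
Definition GA_relators (b : VB2) : set F3 :=
  [set x1^-1 * phiA b x1; x2^-1 * phiA b x2].

Definition GA (b : VB2) : groupType := presented (GA_relators b).

(* The virtual trefoil knot is the closure of this braid. *)
Definition virtual_trefoil : VB2 := sigma1 ^- 2 * rho1.

Definition GK1 : groupType := GA virtual_trefoil.

Lemma GK1_relators : GA_relators virtual_trefoil =
  [set x1^-1 * (y^-1 * x1^-1 * y ^+ 2 * x2 * y ^- 2 * x1 * y);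
       x2^-1 * (y^-1 * x1^-1 * y ^+ 2 * x2^-1 * y ^- 2 * x1 * y
                  * y * x2 * y ^- 2 * x1 * y)].
Proof.
have phiE z : phiA virtual_trefoil z =
    rho1_endo (sigma1_endoV (sigma1_endoV z)).
  by rewrite /virtual_trefoil -expVgn expgS expg1 !gmulfM /= phiA_sigma1V phiA_rho1.
rewrite /GA_relators !phiE.
congr [set _ * _; _ * _]; rewrite /sigma1_endoV /rho1_endo.
  by rewrite !(conjgE, endoE) !expgS !expg0 !mulg1 !invgM !invgK !mulgA.
by rewrite !(conjgE, endoE) !expgS !expg0 !mulg1 !invgM !invgK !mulgA !mulgK.
Qed.

(* Main.v *)
From HB Require Import structures.
Require Import Defs.
From mathcomp Require Import all_boot all_order all_algebra.
From mathcomp Require Import ring zify.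
From mathcomp Require Import boolp classical_sets.

(* Eliminating x2 with the first relation and putting a = x1, b = x1^-1 y turns
   GK1 into the one-relator group <a, b | [[[a, b], b^-1], a] = 1>.  The relator
   lies in gamma_4 of the free group, hence the isomorphism of the quotients by
   gamma_4.  Modulo gamma_5 it is the inverse of [a, b, b, a], which is also
   congruent to [a, b, a, b]; so gamma_4 / gamma_5 is generated by [a, b, a, a]
   and [a, b, b, b], whereas in the free group three generators are needed.
   The lower bounds come from affine groups over Z / p^4, with linear parts 1
   modulo p, where gamma_4 acts by multiples of p^3 and gamma_5 trivially: all p
   are used for the independence over Z, and p = 2 for the free group.

   For the second part, y_i = y^(a^i) turns the relation into
   y_3 = y_2 y_1^-2 y_0 y_1^-1 y_2^2, so that a acts by conjugation on the
   subgroup generated by y_0, y_1, y_2 as the automorphism tau of F3.  This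
   subgroup is the kernel of a |-> 1, y |-> 0, and it is free because GK1 maps
   to the holomorph of F3 by a |-> tau, y |-> y_0. *)

Set Implicit Arguments.
Unset Strict Implicit.
Unset Printing Implicit Defensive.

Local Open Scope classical_set_scope.
Local Open Scope group_scope.

Local Notation gmorphism := UMagmaMorphism.type.

(** * Generating sets and lower central series *)

Lemma morph_umagma (G H : groupType) (f : G -> H) :
  {morph f : x y / x * y} -> monoid_morphism f.
Proof.
by move=> fM; split=> //; apply: (@mulgI _ (f 1)); rewrite -fM !mulg1.
Qed.

Definition gmorph (G H : groupType) (f : G -> H)
    (fM : {morph f : x y / x * y}) : gmorphism G H :=
  HB.pack f (isUMagmaMorphism.Build G H f (morph_umagma fM)).

Lemma isomorphic_sym (G H : groupType) : isomorphic G H -> isomorphic H G.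
Proof.
case=> f [g fg gf]; exists (gmorph (can2_gmulfM fg gf)).
by exists f.
Qed.

Lemma bij_isomorphic (G H : groupType) (f : gmorphism G H) :
  (forall x, f x = 1 -> x = 1) -> (forall y, exists x, f x = y) ->
  isomorphic G H.
Proof.
move=> /gmulf_inj finj fsurj; exists f.
have [g gK] := boolp.choice fsurj.
by exists g => // x; apply: finj; rewrite gK.
Qed.

Lemma conjg_mulR (G : groupType) (x y : G) : x ^ y = x * [~ x, y].
Proof. by rewrite /commg mulVKg. Qed.

Lemma commMgJ (G : groupType) (x y z : G) :
  [~ x * y, z] = [~ x, z] ^ y * [~ y, z].
Proof. by rewrite /commg /conjg !gnorm. Qed.

Lemma commgMJ (G : groupType) (x y z : G) :
  [~ x, y * z] = [~ x, z] * [~ x, y] ^ z.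
Proof. by rewrite /commg /conjg !gnorm. Qed.

Section Generation.
Variable G : groupType.

Definition generates (A : set G) : Prop :=
  forall M : subgroup G, A `<=` M -> forall x, sgset M x.

Definition mksubgroup (P : G -> Prop) (P1 : P 1)
    (PF : forall x y, P x -> P y -> P (x / y)) : subgroup G :=
  @Subgroup G [set x | P x] (group_closedI P1 PF).

Lemma generates_ind (A : set G) (P : G -> Prop) : generates A -> P 1 ->
  (forall x y, P x -> P y -> P (x / y)) -> A `<=` P -> forall x, P x.
Proof. by move=> gA P1 PF AP x; apply: (gA (mksubgroup P1 PF)). Qed.

Lemma generates_eq (A : set G) (H : groupType) (f g : gmorphism G H) :
  generates A -> {in A, f =1 g} -> f =1 g.
Proof.
move=> gA fg; apply: (generates_ind gA); first by rewrite !gmulf1.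
- by move=> x y fx fy; rewrite !gmulfF fx fy.
- by move=> x Ax; apply: fg; apply/mem_set.
Qed.

Lemma generates_mulr_ind (A : set G) (P : G -> Prop) : generates A -> P 1 ->
  (forall a x, A a -> P x -> P (x * a) /\ P (x / a)) -> forall x, P x.
Proof.
move=> gA P1 PA x; rewrite -[x]mul1g.
(* The elements such that right multiplication by them and by their inverse preserves [P] form a
   subgroup containing [A]. *)
have PM : forall x,
    (forall z, P z -> P (z * x)) /\ (forall z, P z -> P (z / x)).
  apply: (generates_ind gA) => [|y z [Py Py'] [Pz Pz']|a Aa].
  - by split=> z; rewrite ?invg1 mulg1.
  - split=> u Pu; first by rewrite mulgA; apply/Pz'/Py.
    by rewrite invgF mulgA; apply/Py'/Pz.
  - by split=> z Pz; have [] := PA _ _ Aa Pz.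
exact: (PM x).1.
Qed.

End Generation.

Section LowerCentralSeries.
Variable G : groupType.
Implicit Types (M : subgroup G) (k : nat).

Lemma lcs_comm k x y : sgset (lcs G k.+1) x -> sgset (lcs G k.+2) [~ x, y].
Proof. by move=> Gx H [_]; apply; exists x => //; exists y. Qed.

Lemma lcs_min k M : (forall x y, sgset (lcs G k.+1) x -> sgset M [~ x, y]) ->
  sgset (lcs G k.+2) `<=` M.
Proof.
move=> GM x; apply; split; first exact: subgroup_closed.
by move=> _ [y Gy [z _ <-]]; apply: GM.
Qed.

Lemma lcs_sub k : sgset (lcs G k.+2) `<=` lcs G k.+1.
Proof.
apply: lcs_min => x y Gx; rewrite /commg.
exact: sgM (sgV Gx) (sgJ y Gx).
Qed.

(** Generation of gamma_(k+1) modulo gamma_(k+2), phrased through the subgroups that contain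
    gamma_(k+2) so that no quotient is formed. The shift skips the redundant index 0 of [lcs]. *)
Definition lcs_gens k (C : set G) : Prop := C `<=` lcs G k.+1 /\
  forall M, lcs G k.+2 `<=` M -> C `<=` M -> lcs G k.+1 `<=` M.

Lemma lcs_gens1 A : generates A -> lcs_gens 0 A.
Proof. by move=> gA; split=> // M _ /gA GM x _. Qed.

(* The commutator map induces a bilinear map
   gamma_k / gamma_(k+1) x G -> gamma_(k+1) / gamma_(k+2). *)
Lemma lcs_gensS k A C : generates A -> lcs_gens k C ->
  lcs_gens k.+1 [set [~ x, y] | x in C & y in A].
Proof.
move=> gA [CG gC]; split=> [_ [x Cx [y Ay <-]]|M GM CM].
  by apply: lcs_comm; apply: CG.
(* [M] contains gamma_(k+3), so conjugation keeps the elements of gamma_(k+2) that lie in [M] inside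
   [M]. *)
have MJ x y : sgset (lcs G k.+2) x -> sgset M x -> sgset M (x ^ y).
  move=> Gx Mx; rewrite conjg_mulR; apply: sgM => //.
  by apply: GM; apply: lcs_comm.
have MJV x y : sgset (lcs G k.+2) x -> sgset M (x ^ y) -> sgset M x.
  by move=> Gx Mx; rewrite -(conjgK y x); apply: MJ => //; apply: sgJ.
suff GM' y : forall x, sgset (lcs G k.+1) x -> sgset M [~ x, y].
  by apply: lcs_min => x y; apply: GM'.
move: y; apply: (generates_ind gA) => [x _|y z My Mz x Gx|y Ay].
- by rewrite commg1; apply: sg1.
- rewrite commgMJ; apply: sgM; last by apply/MJ/My => //; apply: lcs_comm.
  apply: (MJV _ z); first exact: lcs_comm.
  suff -> : [~ x, z^-1] ^ z = [~ x, z]^-1 by apply/sgV/Mz.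
  by rewrite /commg /conjg !gnorm.
have RC x : sgset (lcs G k.+1) x -> forall z, sgset (lcs G k.+2) [~ x, z].
  by move=> Gx z; apply: lcs_comm.
(* For a fixed generator [y], linearity in the first argument makes these [x] a subgroup; it
   contains gamma_(k+2) and [C], hence gamma_(k+1). *)
suff gP : group_closed (mem [set x | sgset (lcs G k.+1) x /\ sgset M [~ x, y]]).
  move=> x Gx; have [||_ //] := gC (Subgroup gP) _ _ x Gx.
  - move=> z Gz; split; first exact: lcs_sub.
    by apply: GM; apply: lcs_comm.
  - move=> c Cc; split; first exact: CG.
    by apply: CM; exists c => //; exists y.
apply: group_closedI => [|x z [Gx Mx] [Gz Mz]].
  by split; [apply: sg1|rewrite comm1g; apply: sg1].
split; first exact: sgM (sgV _).
have GzV : sgset (lcs G k.+1) z^-1 by apply: sgV.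
rewrite commMgJ; apply: sgM; first by apply: MJ => //; apply: RC.
apply: (MJV _ z); first exact: RC.
suff -> : [~ z^-1, y] ^ z = [~ z, y]^-1 by apply: sgV.
by rewrite /commg /conjg !gnorm.
Qed.
End LowerCentralSeries.

Section Morphisms.
Variables (G H : groupType) (f : gmorphism G H).

Lemma lcs_morph k x : sgset (lcs G k) x -> sgset (lcs H k) (f x).
Proof.
case: k => // k; elim: k x => // k IH.
suff MF : forall x y, sgset (lcs H k.+2) (f x) -> sgset (lcs H k.+2) (f y) ->
    sgset (lcs H k.+2) (f (x / y)).
  have M1 : sgset (lcs H k.+2) (f 1) by rewrite gmulf1; apply: sg1.
  apply: (@lcs_min G k (mksubgroup M1 MF)) => x y /IH Gx.
  by rewrite /sgset /= gmulfR; apply: lcs_comm.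
by move=> x y Gx Gy; rewrite gmulfF; apply: sgM => //; apply: sgV.
Qed.

Lemma lcs_surj k : (forall y, exists x, f x = y) ->
  forall y, sgset (lcs H k) y -> exists2 x, sgset (lcs G k) x & f x = y.
Proof.
move=> fsurj; case: k => [|k].
  by move=> y _; have [x] := fsurj y; exists x.
elim: k => [y _|k IH]; first by have [x] := fsurj y; exists x.
pose P y := exists2 x, sgset (lcs G k.+2) x & f x = y.
have P1 : P 1 by exists 1; [apply: sg1|apply: gmulf1].
have PF y z : P y -> P z -> P (y / z).
  move=> [x Gx <-] [x' Gx' <-]; exists (x / x'); last by rewrite gmulfF.
  by apply: sgM => //; apply: sgV.
apply: (@lcs_min H k (mksubgroup P1 PF)) => y z /IH[x Gx <-].
have [x' <-] := fsurj z; exists [~ x, x']; last by rewrite gmulfR.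
exact: lcs_comm.
Qed.

Lemma generates_morph (A : set G) : (forall y, exists x, f x = y) ->
  generates A -> generates (f @` A).
Proof.
move=> fsurj gA M AM y; have [x <-] := fsurj y; move: x.
apply: (generates_ind gA); first by rewrite gmulf1; apply: sg1.
- by move=> x z Mx Mz; rewrite gmulfF; apply: sgM => //; apply: sgV.
- by move=> x Ax; apply: AM; exists x.
Qed.

Lemma quot_lift (N : nsubgroup G) : (forall x, sgset N x -> f x = 1) ->
  exists g : gmorphism (quot N) H, forall x, g (qproj N x) = f x.
Proof.
move=> fN; pose g (u : quot N) := f (repr u).
have gE x : g (qproj N x) = f x.
  have := fN _ (repr_qproj N x); rewrite gmulfM gmulfV.
  by move=> /mulg1_eq; rewrite invgK.
have gM : {morph g : u v / u * v}.
  move=> u v; rewrite -(qproj_repr u) -(qproj_repr v) -gmulfM !gE.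
  exact: gmulfM.
by exists (gmorph gM).
Qed.

Lemma ker_closed : group_closed (mem [set x | f x = 1]).
Proof.
apply: group_closedI => [|x y fx fy]; first exact: gmulf1.
by rewrite /mkset gmulfF fx fy divgg.
Qed.

Lemma ker_normal : normal_set (Subgroup ker_closed).
Proof. by move=> x y fx; rewrite /sgset /mkset gmulfJ fx conj1g. Qed.

Definition ker : nsubgroup G := NSubgroup ker_normal.

End Morphisms.

Lemma quot_ker_isomorphic (G H : groupType) (f : gmorphism G H) :
  (forall y, exists x, f x = y) -> isomorphic (quot (ker f)) H.
Proof.
move=> fsurj; have [g gE] := @quot_lift G H f (ker f) (fun x => id).
apply: (bij_isomorphic (f := g)) => [u|y].
  by rewrite -[u]qproj_repr gE => fu; apply/qproj_eq1.
by have [x <-] := fsurj y; exists (qproj _ x); rewrite gE.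
Qed.

Lemma qproj_surj (G : groupType) (N : nsubgroup G) (u : quot N) :
  exists x, qproj N x = u.
Proof. by exists (repr u); apply: qproj_repr. Qed.

Lemma lcs_quot (G : groupType) k l (u : quot (lcs G l)) :
  sgset (lcs (quot (lcs G l)) k) u ->
  exists2 x, sgset (lcs G k) x & qproj (lcs G l) x = u.
Proof. by apply: lcs_surj; apply: qproj_surj. Qed.

(* If all commutators [x, g] are central, then g |-> [x, g] is a morphism to an
   abelian group. *)
Lemma comm_comm1 (G : groupType) (x g h : G) :
  (forall z z', commute [~ x, z] z') -> [~ x, [~ g, h]] = 1.
Proof.
move=> xc; have xcM z z' : [~ x, z * z'] = [~ x, z'] * [~ x, z].
  by rewrite commgMJ; congr (_ * _); apply/conjg_fixP/commgP; apply: xc.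
apply: (@mulgI _ [~ x, h * g]); rewrite mulg1.
have -> : [~ x, h * g] * [~ x, [~ g, h]] = [~ x, h * g * [~ g, h]].
  by rewrite [RHS]xcM; apply: xc.
by rewrite -commgC !xcM; apply: xc.
Qed.

Lemma qprojR (G : groupType) (N : nsubgroup G) :
  {morph qproj N : x y / [~ x, y]}.
Proof. exact: gmulfR. Qed.

(** An instance of [gamma_i, gamma_2] <= gamma_(i+2): modulo gamma_(k+3) every [x, z] is central,
    and [comm_comm1] applies. *)
Lemma lcs_comm2 (G : groupType) k (x g h : G) :
  sgset (lcs G k.+1) x -> sgset (lcs G k.+3) [~ x, [~ g, h]].
Proof.
move=> Gx; apply/qproj_eq1; rewrite !qprojR; apply: comm_comm1 => u v.
have [y <-] := qproj_surj u; have [z <-] := qproj_surj v.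
apply/commgP/eqP; rewrite -(qprojR _ x y) -(qprojR _ [~ x, y] z).
apply/qproj_eq1.
by do 2!apply: lcs_comm.
Qed.

(** With c = [a, b], one has a b = b a c. Since [c, c] = 1, the elements [c, a b] and [c, b a] agree
    modulo gamma_5. Expanding both and cancelling [c, a] and [c, b], which commute modulo gamma_5,
    leaves [c, a, b] against [c, b, a]. *)
Lemma lcs_commAC (G : groupType) (a b : G) :
  qproj (lcs G 5) [~ a, b, a, b] = qproj (lcs G 5) [~ a, b, b, a].
Proof.
set q := qproj _; set c := [~ a, b].
have qM : {morph q : x y / x * y} by apply: qprojM.
have q1 z : sgset (lcs G 5) z -> q z = 1 by move=> /qproj_eq1.
have qcomm x y : sgset (lcs G 5) [~ x, y] -> q x * q y = q y * q x.
  by move=> /q1 xy; rewrite -!qM (commgC x) qM xy mulg1.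
have Gc z : sgset (lcs G 3) [~ c, z] by do 2!apply: lcs_comm.
have E1 : q [~ c, a * b] = q [~ c, b * a].
  rewrite (commgC a b) -/c commgMJ commgg mul1g conjg_mulR qM.
  rewrite [X in _ * X]q1 ?mulg1 //.
  by apply: lcs_comm2; do 2!apply: lcs_comm.
have E2 : q [~ c, b] * q [~ c, a] = q [~ c, a] * q [~ c, b].
  by apply: qcomm; apply: lcs_comm2.
move: E1; rewrite !commgMJ (conjg_mulR [~ c, a] b) (conjg_mulR [~ c, b] a).
have qM3 u v w : q (u * (v * w)) = q u * q v * q w by rewrite !qM mulgA.
by rewrite (qM3 [~ c, b] [~ c, a]) (qM3 [~ c, a] [~ c, b]) E2 => /mulgI.
Qed.

(** * Integer powers and morphisms from Z^2 *)

Section IntPower.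
Variable G : groupType.
Implicit Types (x y : G) (n : int).

Definition zpow x n : G :=
  match n with Posz m => x ^+ m | Negz m => x ^- m.+1 end.

Lemma zpowS x n : zpow x (n + 1)%R = zpow x n * x.
Proof.
case: n => [m|[|m]]; first by rewrite GRing.addrC -intS /= expgSr.
  by rewrite mulVg.
have -> : (Negz m.+1 + 1 = Negz m :> int)%R by lia.
by rewrite /= (expgS x m.+1) invgM mulgVK.
Qed.

Lemma zpowP x n : zpow x (n - 1)%R = zpow x n / x.
Proof. by rewrite -[in RHS](GRing.subrK 1%R n) zpowS mulgK. Qed.

Lemma zpowD x :
  {morph (zpow x : Algebra.to_multiplicative int -> G) : m n / m * n}.
Proof.
move=> m n; change (zpow x (m + n)%R = zpow x m * zpow x n).
elim/int_rect: n => [|n IH|n IH]; first by rewrite GRing.addr0 mulg1.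
- by rewrite intS [(1 + _)%R]GRing.addrC GRing.addrA !zpowS IH mulgA.
- by rewrite intS [(1 + _)%R]GRing.addrC GRing.opprD GRing.addrA !zpowP IH
    mulgA.
Qed.

Lemma zpow1g n : zpow 1 n = 1.
Proof. by case: n => m; rewrite /= expg1n ?invg1. Qed.

Lemma zpow_commute x y n : commute x y -> commute (zpow x n) y.
Proof.
move=> /commute_sym xy; apply: commute_sym.
by case: n => m; [|apply: commuteV]; apply: commuteX.
Qed.

Lemma zpow_pair x y : commute x y ->
  exists F : gmorphism (Algebra.to_multiplicative (int * int)%type) G,
    forall u : int * int, F u = zpow x u.1 * zpow y u.2.
Proof.
move=> xy; pose F (u : Algebra.to_multiplicative (int * int)%type) :=
  zpow x u.1 * zpow y u.2.
suff FM : {morph F : u v / u * v} by exists (gmorph FM).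
move=> u v; rewrite /F (zpowD x u.1 v.1) (zpowD y u.2 v.2) -!mulgA.
congr (_ * _); rewrite !mulgA; congr (_ * _).
by do 2!(apply: zpow_commute; apply: commute_sym).
Qed.

End IntPower.

Lemma gmulf_zpow (G H : groupType) (f : gmorphism G H) n :
  {morph f : x / zpow x n}.
Proof. by move=> x; case: n => m; [apply: gmulfXn|apply: gmulfXVn]. Qed.

(** * Lower central factors of two-generator groups *)

Section TwoGenerators.
Variables (G : groupType) (a b : G).
Hypothesis gab : generates [set a; b].
Let c := [~ a, b].

Lemma lcs_gens2 : lcs_gens 1 [set c].
Proof.
have [_ g2] := lcs_gensS gab (lcs_gens1 gab); split=> [_ ->|M MG Mc].
  exact: lcs_comm.
have {Mc} : sgset M c by apply: Mc.
move=> Mc; apply: g2 => // _ [x [] -> [y [] -> <-]]; rewrite ?commgg //.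
1,3: exact: sg1.
by rewrite -invgR; apply: sgV.
Qed.

Lemma lcs_gens3 : lcs_gens 2 [set [~ c, a]; [~ c, b]].
Proof.
have [g2s g2] := lcs_gensS gab lcs_gens2; split=> [_ [] ->|M MG Mc].
- by do 2!apply: lcs_comm.
- by do 2!apply: lcs_comm.
by apply: g2 => // _ [x -> [y [] -> <-]]; apply: Mc; [left|right].
Qed.

Lemma lcs_gens4 : lcs_gens 3 [set [~ c, a, a]; [~ c, b, a]; [~ c, b, b]].
Proof.
have [g3s g3] := lcs_gensS gab lcs_gens3; split=> [_ [[]|] ->|M MG Mc].
- by do 3!apply: lcs_comm.
- by do 3!apply: lcs_comm.
- by do 3!apply: lcs_comm.
apply: g3 => // _ [x [] -> [y [] -> <-]]; try by apply: Mc; do ?[by right|left].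
(* The only commutator left is [c, a, b], congruent to the generator [c, b, a]. *)
have /qproj_eq/MG McV := lcs_commAC a b.
have Mc' : sgset M [~ c, b, a] by apply: Mc; left; right.
by have := sgV (sgM McV (sgV Mc')); rewrite mulgK invgK.
Qed.

(** The relation puts [c, b, a] into gamma_5: [c, b] = v [v, b], where v is the inverse of
    [c, b^-1]. As v commutes with a, only [v, b, a] survives, and v lies in gamma_3. *)
Lemma lcs_gens4_rel : commute [~ c, b^-1] a ->
  lcs_gens 3 [set [~ c, a, a]; [~ c, b, b]].
Proof.
move=> rel; have [g4s g4] := lcs_gens4; split=> [_ [] ->|M MG Mc].
- by do 3!apply: lcs_comm.
- by do 3!apply: lcs_comm.
apply: g4 => // _ [[]|] ->; try by apply: Mc; do ?[by right|left].
apply: MG; set v := [~ c, b^-1]^-1.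
have -> : [~ c, b] = v * [~ v, b].
  by rewrite -conjg_mulR /v /commg /conjg !gnorm.
have /commgP/eqP va : commute v a.
  by apply: commute_sym; apply: commuteV; apply: commute_sym.
rewrite commMgJ va conj1g mul1g; do 2!apply: lcs_comm.
by apply: sgV; do 2!apply: lcs_comm.
Qed.
End TwoGenerators.

(** * Affine groups *)

(* Pairs (u, v) standing for the affine map t |-> t * u + v of R, composed from
   left to right. *)
Section AffineGroup.
Import GRing.Theory.
Variable R : comUnitRingType.

Definition aff : Type := {p : R * R | p.1 \is a GRing.unit}.
HB.instance Definition _ := SubChoice.on aff.

Definition affine (u v : R) (uU : u \is a GRing.unit) : aff :=
  exist _ (u, v) uU.

Lemma aff_one_subproof : (1%R : R) \is a GRing.unit.
Proof. exact: unitr1. Qed.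
Lemma aff_mul_subproof (x y : aff) : ((val x).1 * (val y).1)%R \is a GRing.unit.
Proof. by rewrite unitrM (valP x) (valP y). Qed.
Lemma aff_inv_subproof (x : aff) : ((val x).1^-1)%R \is a GRing.unit.
Proof. by rewrite unitrV (valP x). Qed.

Definition aff_one : aff := affine 0%R aff_one_subproof.
Definition aff_mul (x y : aff) : aff :=
  affine ((val x).2 * (val y).1 + (val y).2)%R (aff_mul_subproof x y).
Definition aff_inv (x : aff) : aff :=
  affine (- ((val x).2 * (val x).1^-1))%R (aff_inv_subproof x).

Lemma aff_eq (x y : aff) :
  (val x).1 = (val y).1 -> (val x).2 = (val y).2 -> x = y.
Proof.
move=> e1 e2; apply: val_inj.
by rewrite [LHS]surjective_pairing e1 e2 -surjective_pairing.
Qed.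

Lemma aff_mulA : associative aff_mul.
Proof. by move=> x y z; apply: aff_eq => /=; ring. Qed.
Lemma aff_mul1 : left_id aff_one aff_mul.
Proof. by move=> x; apply: aff_eq => /=; ring. Qed.
Lemma aff_mulr1 : right_id aff_one aff_mul.
Proof. by move=> x; apply: aff_eq => /=; ring. Qed.
Lemma aff_mulV : left_inverse aff_one aff_inv aff_mul.
Proof.
move=> x; apply: aff_eq => /=; first by rewrite mulVr ?(valP x).
by rewrite mulNr mulrVK ?(valP x) // addNr.
Qed.
Lemma aff_mulrV : right_inverse aff_one aff_inv aff_mul.
Proof.
move=> x; apply: aff_eq => /=; first by rewrite mulrV ?(valP x).
by rewrite addrN.
Qed.

HB.instance Definition _ :=
  isGroup.Build aff aff_mulA aff_mul1 aff_mulr1 aff_mulV aff_mulrV.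

Definition transl (v : R) : aff := affine v aff_one_subproof.

Lemma translD :
  {morph (transl : Algebra.to_multiplicative R -> aff) : v w / v * w}.
Proof. by move=> v w; apply: aff_eq => /=; rewrite mulr1. Qed.

(** The linear parts commute, so a commutator is a translation, found by comparing x y with y x. *)
Lemma comm_aff (x y : aff) :
  [~ x, y] =
  transl ((val x).2 * ((val y).1 - 1) - (val y).2 * ((val x).1 - 1))%R.
Proof.
by apply: (@mulgI _ (y * x)); rewrite -commgC; apply: aff_eq => /=; ring.
Qed.

Lemma comm_transl v (x : aff) :
  [~ transl v, x] = transl (v * ((val x).1 - 1))%R.
Proof. by rewrite comm_aff /= subrr mulr0 subr0. Qed.

Lemma zpow_transl v n : zpow (transl v) n = transl (v *~ n)%R.
Proof.
have tX m : transl v ^+ m = transl (v *+ m)%R.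
  elim: m => [|m IH]; first by apply: aff_eq.
  by rewrite expgS IH mulrS; apply: esym; apply: translD.
case: n => m /=; rewrite tX //.
by apply: aff_eq => /=; rewrite ?invr1 // mulr1.
Qed.

Section Filtration.
Variables (G : groupType) (A : set G) (f : gmorphism G aff) (d : R).
Hypotheses (gA : generates A).
Hypothesis fA : forall x, A x -> exists r, (val (f x)).1 = (1 + d * r)%R.

Lemma aff_linear x : exists r, (val (f x)).1 = (1 + d * r)%R.
Proof.
move: x; apply: (generates_ind gA) => //.
  by exists 0%R; rewrite gmulf1 /= mulr0 addr0.
move=> x y [r xr] [s ys]; rewrite gmulfF /= xr.
(* From (1 + d r) / (1 + d s) = 1 + d (r - s) / (1 + d s). *)
have yU := valP (f y); exists ((r - s) / (1 + d * s))%R.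
apply: (mulIr yU); rewrite ys mulrVK -?ys // mulrDl mulrA mulrVK //.
by rewrite mul1r ys; ring.
Qed.

(** A first commutator is a translation by a multiple of d, and each further commutator with an
    element of linear part 1 + d s multiplies the translation by d s. *)
Lemma aff_lcs k x : sgset (lcs G k.+2) x ->
  exists r, f x = transl (d ^+ k.+1 * r)%R.
Proof.
elim: k x => [|k IH].
all: pose P k x := exists r, f x = transl (d ^+ k.+1 * r)%R.
all: have P1 l : P l 1 by exists 0%R; rewrite gmulf1 mulr0.
all: have PF l x y : P l x -> P l y -> P l (x / y).
all: try by move=> [r xr] [s ys]; exists (r - s)%R; rewrite gmulfF xr ys;
  apply: aff_eq => /=; rewrite ?invr1; ring.
- apply: (@lcs_min G 0 (mksubgroup (P1 0) (PF 0))) => x y _.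
  rewrite /sgset /= /P.
  have [[r xr] [s ys]] := (aff_linear x, aff_linear y).
  rewrite gmulfR comm_aff xr ys.
  exists ((val (f x)).2 * s - (val (f y)).2 * r)%R.
  by congr transl; ring.
- apply: (@lcs_min G k.+1 (mksubgroup (P1 k.+1) (PF k.+1))) => x y /IH[r xr].
  have [s ys] := aff_linear y.
  rewrite /sgset /= /P gmulfR xr comm_transl ys; exists (r * s)%R.
  by congr transl; rewrite [in RHS]exprS; ring.
Qed.

End Filtration.
End AffineGroup.

(** * A two-generator presentation of the trefoil group *)

Lemma Free_generates (I : choiceType) : generates [set fgen i | i in [set: I]].
Proof.
move=> M genM x; rewrite -(flift_fgen x) /flift.
elim/big_ind: _ => [|u v|[i []] _]; [exact: sg1|exact: sgM|..].
all: rewrite /lletter /=.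
  by apply: genM; exists i.
by apply: sgV; apply: genM; exists i.
Qed.

Lemma ord3_cases (P : 'I_3 -> Prop) : P (@Ordinal 3 0 isT) ->
  P (@Ordinal 3 1 isT) -> P (@Ordinal 3 2 isT) -> forall i, P i.
Proof.
by move=> ? ? ? [[|[|[|//]]] lti]; rewrite (bool_irrelevance lti isT). Qed.

Lemma ord2_cases (P : 'I_2 -> Prop) : P (@Ordinal 2 0 isT) ->
  P (@Ordinal 2 1 isT) -> forall i, P i.
Proof. by move=> ? ? [[|[|//]] lti]; rewrite (bool_irrelevance lti isT). Qed.

Section TrefoilWords.
Variable H : groupType.
Implicit Types a b p q z : H.

Definition trefoil_r1 p q z : H :=
  p^-1 * (z^-1 * p^-1 * z ^+ 2 * q * z ^- 2 * p * z).

Definition trefoil_r2 p q z : H :=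
  q^-1 * (z^-1 * p^-1 * z ^+ 2 * q^-1 * z ^- 2 * p * z
            * z * q * z ^- 2 * p * z).

(* The value of x2 forced by the first relation. *)
Definition trefoil_x2 p z : H := p ^ (z^-1 * p^-1 * z ^+ 2).

Lemma trefoil_r1E p q z :
  trefoil_r1 p q z = 1 -> q = trefoil_x2 p z.
Proof.
move=> /mulg1_eq; rewrite invgK => pE.
by rewrite /trefoil_x2 /conjg [X in _ * (X * _)]pE !expg2 !gnorm.
Qed.

Lemma trefoil_r1_x2 p z : trefoil_r1 p (trefoil_x2 p z) z = 1.
Proof. by rewrite /trefoil_r1 /trefoil_x2 !expg2 /conjg !gnorm. Qed.

(** With x2 eliminated and y = a b, the second relator is conjugate to [a^-1, t a^-2] for t =
    [a, b, b^-1]. It is therefore trivial exactly when t commutes with a. *)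
Lemma trefoil_r2_x2 a b : trefoil_r2 a (trefoil_x2 a (a * b)) (a * b) =
  [~ a^-1, [~ a, b, b^-1] * a^-1 * a^-1] ^ (a * b * a * trefoil_x2 a (a * b)).
Proof.
by rewrite /trefoil_r2 /trefoil_x2 /commg !expg2 /conjg !gnorm.
Qed.

Lemma trefoil_r2_x2_eq1 a b :
  trefoil_r2 a (trefoil_x2 a (a * b)) (a * b) = 1 <-> commute [~ a, b, b^-1] a.
Proof.
rewrite trefoil_r2_x2; set t := [~ a, b, b^-1].
split=> [/eqP|ta]; last first.
  suff /commgP/eqP -> : commute a^-1 (t * a^-1 * a^-1) by rewrite conj1g.
  have aV : commute a^-1 a^-1 by [].
  do 2?apply: commuteM => //.
  by apply: commute_sym; apply: commuteV.
rewrite conjg_eq1 => /commgP ta; apply: commute_sym.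
have aa : commute a a by [].
have -> : t = t * a^-1 * a^-1 * a * a by rewrite !mulgVK.
do 2!apply: commuteM => //.
apply: commute_sym; rewrite -[X in commute _ X]invgK.
exact/commuteV/commute_sym.
Qed.

End TrefoilWords.

Definition ga : GK1 := pgen (GA_relators virtual_trefoil) (@Ordinal 3 0 isT).
Definition gy : GK1 := pgen (GA_relators virtual_trefoil) (@Ordinal 3 2 isT).
Definition gb : GK1 := ga^-1 * gy.

Lemma GA_relators_trefoil : GA_relators virtual_trefoil =
  [set trefoil_r1 x1 x2 y; trefoil_r2 x1 x2 y].
Proof. exact: GK1_relators. Qed.

Lemma morph_r1 (H : groupType) (f : gmorphism F3 H) p q z :
  f (trefoil_r1 p q z) = trefoil_r1 (f p) (f q) (f z).
Proof. by rewrite /trefoil_r1 !expg2 !(gmulfM, gmulfV). Qed.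

Lemma morph_r2 (H : groupType) (f : gmorphism F3 H) p q z :
  f (trefoil_r2 p q z) = trefoil_r2 (f p) (f q) (f z).
Proof. by rewrite /trefoil_r2 !expg2 !(gmulfM, gmulfV). Qed.

Lemma relator_eq1 (I : choiceType) (R : set (Free I)) r :
  R r -> qproj (normal_closure R) r = 1.
Proof. by move=> Rr; apply/qproj_eq1 => N [_]; apply. Qed.

Definition GK1_proj : gmorphism F3 GK1 :=
  qproj (normal_closure (GA_relators virtual_trefoil)).

Lemma GK1_r1 : trefoil_r1 (GK1_proj x1) (GK1_proj x2) (GK1_proj y) = 1.
Proof.
rewrite -morph_r1; apply: relator_eq1.
by rewrite GA_relators_trefoil; left.
Qed.

Lemma GK1_r2 : trefoil_r2 (GK1_proj x1) (GK1_proj x2) (GK1_proj y) = 1.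
Proof.
rewrite -morph_r2; apply: relator_eq1.
by rewrite GA_relators_trefoil; right.
Qed.

Lemma GK1_rel : commute [~ ga, gb, gb^-1] ga.
Proof.
apply/trefoil_r2_x2_eq1; rewrite /gb mulVKg.
have := GK1_r2; rewrite [GK1_proj x2](trefoil_r1E GK1_r1); exact.
Qed.

Lemma GK1_generates : generates [set ga; gb].
Proof.
move=> M abM; have Ma : sgset M ga by apply: abM; left.
have My : sgset M gy.
  by rewrite -(mulVKg ga gy); apply: sgM => //; apply: abM; right.
have proj_surj : forall u : GK1, exists x, GK1_proj x = u by apply: qproj_surj.
apply: (generates_morph proj_surj (@Free_generates 'I_3)) => _ [_ [i _ <-] <-].
move: i; apply: ord3_cases => //.
rewrite -[fgen _]/x2 (trefoil_r1E GK1_r1) /trefoil_x2 /conjg.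
have Mw : sgset M (gy^-1 * ga^-1 * gy ^+ 2).
  by rewrite expg2; do ?[exact: sgV|apply: sgM].
by do ?[exact: sgV|apply: sgM].
Qed.

(** The universal property of the one-relator presentation. Together with [GK1_generates] and
    [GK1_rel] it replaces an explicit isomorphism with the one-relator group. *)
Lemma GK1_lift (H : groupType) (a b : H) : commute [~ a, b, b^-1] a ->
  exists f : gmorphism GK1 H, f ga = a /\ f gb = b.
Proof.
move=> rel; pose g := tnth [tuple a; trefoil_x2 a (a * b); a * b].
have gr r : GA_relators virtual_trefoil r -> flift g r = 1.
  rewrite GA_relators_trefoil; move=> [] ->.
    by rewrite morph_r1 /= !flift_gen; apply: trefoil_r1_x2.
  by rewrite morph_r2 /= !flift_gen; apply/trefoil_r2_x2_eq1.
exists (gmorph (pliftM gr)).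
have fa : gmorph (pliftM gr) ga = a.
  by rewrite /= /ga /pgen /= (plift_proj gr) flift_gen.
have fy : gmorph (pliftM gr) gy = a * b.
  by rewrite /= /gy /pgen /= (plift_proj gr) flift_gen.
by split=> //; rewrite gmulfM gmulfV fa fy mulKg.
Qed.

(** * The free kernel *)

Section Holomorph.
Variable K : groupType.

(* The pair (f, x) stands for the map k |-> f k * x, and products act from left
   to right, as in Aut. *)
Definition hol : Type := (Aut K * K)%type.
HB.instance Definition _ := Choice.on hol.

Definition hol_one : hol := (1, 1).
Definition hol_mul (p q : hol) : hol := (p.1 * q.1, aut_fun q.1 p.2 * q.2).
Definition hol_inv (p : hol) : hol := (p.1^-1, aut_fun p.1^-1 p.2^-1).

Lemma autM (f : Aut K) : {morph aut_fun f : x y / x * y}.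
Proof. exact: (autP f).1. Qed.

Lemma aut1 (f : Aut K) : aut_fun f 1 = 1.
Proof. exact: (@gmulf1 _ _ (gmorph (@autM f))). Qed.

Lemma autV (f : Aut K) : {morph aut_fun f : x / x^-1}.
Proof. exact: (gmulfV (gmorph (@autM f))). Qed.

Lemma hol_mulA : associative hol_mul.
Proof. by move=> p q r; rewrite /hol_mul /= autM !mulgA. Qed.
Lemma hol_mul1 : left_id hol_one hol_mul.
Proof. by move=> [f x]; rewrite /hol_mul /= aut1 !mul1g. Qed.
Lemma hol_mulr1 : right_id hol_one hol_mul.
Proof. by move=> [f x]; rewrite /hol_mul /= !mulg1. Qed.
Lemma hol_mulV : left_inverse hol_one hol_inv hol_mul.
Proof.
move=> [f x]; rewrite /hol_mul /= mulVg -aut_mulE mulVg.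
by rewrite [aut_fun 1 _]/(x^-1) mulVg.
Qed.
Lemma hol_mulrV : right_inverse hol_one hol_inv hol_mul.
Proof. by move=> [f x]; rewrite /hol_mul /= mulgV -autM mulgV aut1. Qed.

HB.instance Definition _ :=
  isGroup.Build hol hol_mulA hol_mul1 hol_mulr1 hol_mulV hol_mulrV.

Definition hol_in (x : K) : hol := (1, x).

Lemma hol_inM : {morph hol_in : x y / x * y}.
Proof.
by move=> x y; rewrite /hol_in [RHS]/(hol_mul _ _) /hol_mul /= mulg1.
Qed.

Lemma hol_inV : {morph hol_in : x / x^-1}.
Proof. exact: (gmulfV (gmorph hol_inM)). Qed.

Definition hol_aut (f : Aut K) : hol := (f, 1).

Lemma hol_inJ (f : Aut K) x : hol_in x ^ hol_aut f = hol_in (aut_fun f x).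
Proof.
apply: (@mulgI _ (hol_aut f)); rewrite -conjgC.
rewrite [LHS]/(hol_mul _ _) [RHS]/(hol_mul _ _) /hol_mul /=.
by rewrite aut1 !mul1g !mulg1.
Qed.

End Holomorph.

(** In terms of y_i = z^(a^i), the element required to commute with a is y_0^-1 y_1^2 y_2^-1. *)
Lemma trefoil_relE (H : groupType) (a z : H) :
  [~ a, a^-1 * z, (a^-1 * z)^-1] = z^-1 * (z * z) ^ a * ((z ^ a) ^ a)^-1.
Proof. by rewrite /commg /conjg !gnorm. Qed.

(** Conjugation by a shifts the indices, so the relation reads y_1^-1 y_2^2 y_3^-1 = y_0^-1 y_1^2
    y_2^-1, which is solved for y_3. *)
Lemma trefoil_conj3 (H : groupType) (a z : H) :
  commute [~ a, a^-1 * z, (a^-1 * z)^-1] a ->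
  let p1 := z ^ a in let p2 := p1 ^ a in
  p2 ^ a = p2 * p1^-1 * p1^-1 * z * p1^-1 * p2 * p2.
Proof.
move=> /commgP; rewrite -conjg_fix trefoil_relE => /eqP E p1 p2.
have {}E : p1^-1 * (p2 * p2) * (p2 ^ a)^-1 = z^-1 * (p1 * p1) * p2^-1.
  transitivity ((z^-1 * (z * z) ^ a * ((z ^ a) ^ a)^-1) ^ a).
    by rewrite /p2 /p1 /conjg !gnorm.
  by rewrite E /p2 /p1 /conjg !gnorm.
have -> : p2 ^ a = (z^-1 * (p1 * p1) * p2^-1)^-1 * (p1^-1 * (p2 * p2)).
  by rewrite -E invgM invgK mulgVK.
by clearbody p1 p2; rewrite !gnorm.
Qed.

(** Here [x1], [x2], [y] stand for y_0, y_1, y_2, not for the generators of the presentation. The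
    inverse expresses y_(-1) through them by the same relation. *)
Definition tau_endo := endo x2 y (y * x2^-1 * x2^-1 * x1 * x2^-1 * y * y).
Definition tau_endoV := endo (x1 * x1 * x2^-1 * y * x2^-1 * x2^-1 * x1) x1 x2.

Lemma tau_endoK : cancel tau_endo tau_endoV.
Proof. by apply: endo_can; rewrite !endoE // !gnorm. Qed.

Lemma tau_endoVK : cancel tau_endoV tau_endo.
Proof. by apply: endo_can; rewrite !endoE // !gnorm. Qed.

Definition tau : Aut F3 := mkAut (endo_aut tau_endoK tau_endoVK).

Lemma tau_x1 : aut_fun tau x1 = x2. Proof. exact: endo_x1. Qed.
Lemma tau_x2 : aut_fun tau x2 = y. Proof. exact: endo_x2. Qed.
Lemma tau_y : aut_fun tau y = y * x2^-1 * x2^-1 * x1 * x2^-1 * y * y.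
Proof. exact: endo_y. Qed.

(** By [hol_inJ], the relation to check becomes the invariance of y_0^-1 y_1^2 y_2^-1 under [tau].
    The image of [gb] is forced by [gb = ga^-1 * gy]. *)
Lemma GK1_hol : exists h : gmorphism GK1 (hol F3),
  h ga = hol_aut tau /\ h gy = hol_in x1.
Proof.
have [|h [ha hb]] := @GK1_lift (hol F3)
  (hol_aut tau) ((hol_aut tau)^-1 * hol_in x1).
  rewrite trefoil_relE -hol_inM !hol_inJ -!hol_inV -!hol_inM.
  apply/commgP; rewrite -conjg_fix hol_inJ; apply/eqP.
  by congr hol_in; rewrite !(autM, autV) tau_x1 tau_x2 tau_y !gnorm.
by exists h; split=> //; rewrite -(mulVKg ga gy) gmulfM ha hb mulVKg.
Qed.

Lemma GK1_winding : exists e : gmorphism GK1 (Algebra.to_multiplicative int),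
  e ga = (1%R : int) /\ e gy = (0%R : int).
Proof.
have [|e [ea eb]] :=
  @GK1_lift (Algebra.to_multiplicative int) (1%R : int) (-1)%R.
  by rewrite /commute; apply: GRing.addrC.
by exists e; split=> //; rewrite -(mulVKg ga gy) gmulfM ea eb.
Qed.

Lemma GK1_semidirect : exists N : nsubgroup GK1,
  isomorphic (sgtype N) (Free 'I_3) /\
  isomorphic (quot N) (Algebra.to_multiplicative int).
Proof.
have [e [ea ey]] := GK1_winding; have [h [ha hy]] := GK1_hol.
(* The identity of the multiplicative copy of Z is the integer 0. *)
have e1 : e gy = 1 by [].
have e_zpow n : e (zpow ga n) = n.
  rewrite gmulf_zpow ea; elim/int_rect: n => // n IH.
    by rewrite intS GRing.addrC zpowS IH.
  by rewrite intS GRing.addrC GRing.opprD zpowP IH.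
exists (ker e); split; last first.
  by apply: quot_ker_isomorphic => n; exists (zpow ga n).
pose J : gmorphism F3 GK1 := flift (tnth [tuple gy; gy ^ ga; (gy ^ ga) ^ ga]).
have Jx1 : J x1 = gy by rewrite /J /= flift_gen.
have Jx2 : J x2 = gy ^ ga by rewrite /J /= flift_gen.
have Jy : J y = (gy ^ ga) ^ ga by rewrite /J /= flift_gen.
have eJ w : e (J w) = 1.
  move: w; apply: (generates_ind (@Free_generates 'I_3)).
  - by rewrite !gmulf1.
  - by move=> u v eu ev; rewrite !gmulfF eu ev divgg.
  - move=> _ [i _ <-]; move: i; apply: ord3_cases.
    + by rewrite -/x1 Jx1.
    + by rewrite -/x2 Jx2 gmulfJ e1 conj1g.
    + by rewrite -/y Jy !gmulfJ e1 !conj1g.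
(* [h] retracts the image of [J] onto F3, so [J] is injective. *)
have hJ w : h (J w) = hol_in w.
  move: w; apply: (generates_ind (@Free_generates 'I_3)).
  - by rewrite !gmulf1.
  - by move=> u v hu hv; rewrite !gmulfF hu hv hol_inM hol_inV.
  - move=> _ [i _ <-]; move: i; apply: ord3_cases.
    + by rewrite -/x1 Jx1 hy.
    + by rewrite -/x2 Jx2 gmulfJ hy ha hol_inJ tau_x1.
    + by rewrite -/y Jy !gmulfJ hy ha !hol_inJ tau_x1 tau_x2.
have gy3 : ((gy ^ ga) ^ ga) ^ ga =
    J (y * x2^-1 * x2^-1 * x1 * x2^-1 * y * y).
  rewrite !(gmulfM, gmulfV) Jx1 Jx2 Jy.
  exact: (trefoil_conj3 GK1_rel).
(* Hence [ga] and its inverse normalize the image of [J], and powers of [ga] can be collected on the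
   left. *)
have Jtau w : J (aut_fun tau w) = J w ^ ga.
  move: w; apply: (generates_ind (@Free_generates 'I_3)).
  - by rewrite aut1 !gmulf1 conj1g.
  - by move=> u v Ju Jv; rewrite autM autV !gmulfF Ju Jv conjMg conjVg.
  - move=> _ [i _ <-]; move: i; apply: ord3_cases.
    + by rewrite -/x1 Jx1 -Jx2 tau_x1.
    + by rewrite -/x2 Jx2 -Jy tau_x2.
    + by rewrite -/y Jy gy3 tau_y.
have JtauV w : J (aut_fun tau^-1 w) = J w ^ ga^-1.
  by rewrite -[in RHS](aut_funVK tau w) Jtau conjgK.
(* Since [e] reads off n, the elements of the kernel are those with n = 0, so [J] is onto the
   kernel. *)
have cover x : exists n w, x = zpow ga n * J w.
  have coverM u z : (exists n w, u = zpow ga n * J w) ->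
      z = ga \/ z = ga^-1 \/ z = gy \/ z = gy^-1 ->
      exists n w, u * z = zpow ga n * J w.
    move=> [n [w ->]] [|[|[]]] ->.
    - exists (n + 1)%R, (aut_fun tau w).
      by rewrite Jtau zpowS conjgE !mulgA mulgK.
    - exists (n - 1)%R, (aut_fun tau^-1 w).
      by rewrite JtauV zpowP conjgE !mulgA mulgK.
    - by exists n, (w * x1); rewrite gmulfM Jx1 mulgA.
    - by exists n, (w * x1^-1); rewrite gmulfM gmulfV Jx1 mulgA.
  move: x; apply: (generates_mulr_ind GK1_generates).
    by exists 0%R, 1; rewrite gmulf1 mulg1.
  move=> _ u [] -> ux; first by split; apply: coverM => //; tauto.
  (* A factor [gb] or its inverse is appended as two letters in [ga] and [gy]. *)
  rewrite /gb invgM invgK !mulgA.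
  by split; (apply: (coverM); last by tauto); apply: coverM => //; tauto.
have kerJ w : J w \in sgset (ker e) by apply/mem_set/eJ.
pose j (w : F3) : sgtype (ker e) := exist _ (J w) (kerJ w).
have jM : {morph j : u v / u * v} by move=> u v; apply/val_inj; apply: gmulfM.
apply/isomorphic_sym/(bij_isomorphic (f := gmorph jM)) => [w jw|[x ex]].
  have Jw : J w = 1 by have := congr1 val jw; rewrite val1.
  by have := hJ w; rewrite Jw gmulf1 => -[].
have [n [w xE]] := cover x; exists w; apply/val_inj => /=.
have := set_mem ex.
rewrite /ker /sgset /mkset /= xE gmulfM eJ mulg1 e_zpow => ->.
by rewrite mul1g.
Qed.

(** * Quotients by the lower central series *)

Definition gcomp (G H K : groupType) (g : gmorphism H K) (f : gmorphism G H) :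
  gmorphism G K := g \o f.

Definition qmorph (G : groupType) (N : nsubgroup G) : gmorphism G (quot N) :=
  qproj N.

Lemma quot_lcs_lift (G H : groupType) k (f : gmorphism G (quot (lcs H k))) :
  exists g : gmorphism (quot (lcs G k)) (quot (lcs H k)),
    forall x, g (qproj (lcs G k) x) = f x.
Proof.
apply: quot_lift => x /(lcs_morph f) /lcs_quot[z Hz <-].
exact/qproj_eq1.
Qed.

Definition fa : Free 'I_2 := fgen (@Ordinal 2 0 isT).
Definition fb : Free 'I_2 := fgen (@Ordinal 2 1 isT).

Lemma F2_generates : generates [set fa; fb].
Proof.
move=> M abM; apply: Free_generates => _ [i _ <-]; move: i.
by apply: ord2_cases; apply: abM; [left|right].
Qed.

Lemma F2_lift (H : groupType) (a b : H) :
  exists f : gmorphism (Free 'I_2) H, f fa = a /\ f fb = b.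
Proof. by exists (flift (tnth [tuple a; b])); rewrite /= !flift_gen. Qed.

(** The relator has weight 4, so sending [ga], [gb] to [fa], [fb] respects it modulo gamma_4. The
    opposite map exists by freeness, and both composites fix the generators. *)
Lemma GK1_quot4 : isomorphic (quot (lcs GK1 4)) (quot (lcs (Free 'I_2) 4)).
Proof.
pose qF := qmorph (lcs (Free 'I_2) 4); pose qG := qmorph (lcs GK1 4).
have [|f [fga fgb]] := @GK1_lift _ (qF fa) (qF fb).
  have : qF [~ fa, fb, fb^-1, fa] = 1.
    by apply/qproj_eq1; do 3!apply: lcs_comm.
  by rewrite !gmulfR gmulfV => /eqP/commgP.
have [g [gfa gfb]] := F2_lift ga gb.
have [f' f'E] := quot_lcs_lift f; have [g' g'E] := quot_lcs_lift (gcomp qG g).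
have fgE : gcomp f g =1 qF.
  apply: (generates_eq F2_generates) => _ /set_mem[] -> /=.
    by rewrite gfa fga.
  by rewrite gfb fgb.
have gfE : gcomp g' f =1 qG.
  apply: (generates_eq GK1_generates) => _ /set_mem[] -> /=.
    by rewrite fga [LHS]g'E /= gfa.
  by rewrite fgb [LHS]g'E /= gfb.
apply: (bij_isomorphic (f := f')) => u; have [x <-] := qproj_surj u.
  by rewrite f'E => fx; rewrite -[LHS]gfE /= fx gmulf1.
by exists (qproj _ (g x)); rewrite f'E; apply: fgE.
Qed.

(** * Affine representations over Z / p^4 *)

Section TruncatedAffine.
Import GRing.Theory.
Variable m : nat.
Let p := m.+2.
(** The shift in [p] keeps the modulus above 1, where ['Z_n] really is Z / n. The exponent is chosen
    so that d^4 = 0 kills gamma_5 while d^3, of additive order p, still detects gamma_4. *)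
Definition tring : comUnitRingType := 'Z_(p ^ 4).
Let d : tring := (p%:R)%R.

Lemma tring_gt1 : (1 < p ^ 4)%N.
Proof. by rewrite -(exp1n 4) ltn_exp2r. Qed.

Lemma tring_d4 : (d ^+ 4 = 0)%R.
Proof. by rewrite /d -natrX; apply: (pchar_Zp tring_gt1). Qed.

Lemma tring_unit : (1 + d)%R \is a GRing.unit.
Proof.
have -> : (1 + d = p.+1%:R)%R by rewrite [RHS]mulrS.
by rewrite unitZpE ?tring_gt1 // coprimeXl // coprimenS.
Qed.

Lemma tring_natr_eq0 k : (d ^+ 3 *+ k == 0)%R = (p %| k)%N.
Proof.
rewrite /d -natrX -mulrnA -(@dvdn_pmul2l (p ^ 3)) ?expn_gt0 // -expnSr.
by rewrite -val_eqE /= [X in X == _](val_Zp_nat tring_gt1).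
Qed.


Lemma tring_mulrz_eq0 n : (d ^+ 3 *~ n == 0)%R = (p %| `|n|)%N.
Proof. by case: n => k; rewrite /= ?oppr_eq0 tring_natr_eq0. Qed.

Lemma transl_eq1 (v : tring) : transl v = 1 -> v = 0%R.
Proof. by move=> /(congr1 (fun x : aff tring => (val x).2)). Qed.

Definition dilation (v : tring) : aff tring := affine v tring_unit.

Section Values.
Variables (G : groupType) (a b : G) (f : gmorphism G (aff tring)).
Hypothesis gab : generates [set a; b].
Hypothesis fab : forall x, [set a; b] x ->
  exists r, (val (f x)).1 = (1 + d * r)%R.

Lemma tring_lcs4 x : sgset (lcs G 4) x ->
  exists r, f x = transl (d ^+ 3 * r)%R.
Proof. exact: (@aff_lcs _ _ _ _ d gab fab 2). Qed.

Lemma tring_lcs5 x : sgset (lcs G 5) x -> f x = 1.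
Proof.
by move=> /(@aff_lcs _ _ _ _ d gab fab 3)[r ->]; rewrite tring_d4 mul0r.
Qed.

End Values.

Lemma dilation_lin v : exists r, (val (dilation v)).1 = (1 + d * r)%R.
Proof. by exists 1%R; rewrite mulr1. Qed.

Lemma transl_lin v : exists r, (val (@transl tring v)).1 = (1 + d * r)%R.
Proof. by exists 0%R; rewrite mulr0 addr0. Qed.

Lemma comm_transl_dilation v w : [~ transl v, dilation w] = transl (v * d)%R.
Proof. by rewrite comm_transl /= addrC addKr. Qed.

Lemma comm_transl_transl v w : [~ transl v, transl w] = 1 :> aff tring.
Proof. by rewrite comm_transl /= subrr mulr0. Qed.

Lemma comm_dilation_transl v :
  [~ dilation 0%R, transl v] = transl (- (v * d))%R.
Proof. by rewrite comm_aff /= mul0r sub0r addrAC subrr add0r. Qed.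

Lemma comm_dilation_dilation v :
  [~ dilation 0%R, dilation v] = transl (- (v * d))%R.
Proof. by rewrite comm_aff /= mul0r sub0r addrAC subrr add0r. Qed.

End TruncatedAffine.

(** The modulus depends on n: p = |n| + 2 exceeds |n|, so p divides |n| only for n = 0. *)
Lemma zpow_transl_tring (n : int) :
  zpow (transl ((`|n|%N.+2%:R : tring `|n|%N) ^+ 3)%R) n = 1 -> n = 0%R.
Proof.
rewrite zpow_transl => /transl_eq1/eqP; rewrite tring_mulrz_eq0 => n_dvd.
have [/eqP|n_gt0] := posnP `|n|%N; first by rewrite absz_eq0 => /eqP.
by have := dvdn_leq n_gt0 n_dvd; lia.
Qed.

Definition sgval (G : groupType) (H : subgroup G) : gmorphism (sgtype H) G :=
  val.

Lemma restrict_lift (G H : groupType) (S : subgroup G) (N : nsubgroup G)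
    (f : gmorphism G H) : (forall x, sgset N x -> f x = 1) ->
  exists g : gmorphism (quot (restrict S N)) H,
    forall s, g (qproj (restrict S N) s) = f (val s).
Proof.
move=> fN; have [s|g gE] := @quot_lift _ _ (gcomp f (sgval S)) (restrict S N).
  exact: fN.
by exists g.
Qed.

(** The first representation sends [a, b, b, b] to the translation by d^3 and kills [a, b, a, a];
    the second does the opposite. The sign in [transl (-1)] makes [a, b] the translation by d. *)
Lemma GK1_aff m :
  (exists f : gmorphism GK1 (aff (tring m)),
    f ga = transl 1%R /\ f gb = dilation 0%R) /\
  (exists f : gmorphism GK1 (aff (tring m)),
    f ga = dilation 0%R /\ f gb = transl (-1)%R).
Proof.
split; apply: GK1_lift.
  rewrite comm_transl_dilation comm_transl; apply/commgP.
  by rewrite comm_transl_transl.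
have -> : (transl (-1) : aff (tring m))^-1 = transl 1%R.
  by apply: mulg1_eq; rewrite -translD; congr transl; apply: GRing.addNr.
rewrite comm_dilation_transl comm_transl_transl; apply: commute_sym.
exact: commute1.
Qed.

(** The classes of A and B commute because [A, B] lies in gamma_5, so they define a morphism [F]
    from Z^2. It is onto by [lcs_gens4_rel] and injective by the two families of [GK1_aff]. *)
Lemma GK1_lcs_factor :
  isomorphic (lcs_factor GK1 4 5) (Algebra.to_multiplicative (int * int)%type).
Proof.
apply: isomorphic_sym.
set A := [~ ga, gb, ga, ga]; set B := [~ ga, gb, gb, gb].
have hA : A \in sgset (lcs GK1 4) by apply/mem_set; do 3!apply: lcs_comm.
have hB : B \in sgset (lcs GK1 4) by apply/mem_set; do 3!apply: lcs_comm.
pose sA : sgtype (lcs GK1 4) := exist _ A hA.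
pose sB : sgtype (lcs GK1 4) := exist _ B hB.
pose qL := qmorph (restrict (lcs GK1 4) (lcs GK1 5)).
have [|F FE] := @zpow_pair _ (qL sA) (qL sB).
  apply/commgP/eqP; rewrite -gmulfR; apply/qproj_eq1.
  change (sgset (lcs GK1 5) (sgval (lcs GK1 4) [~ sA, sB])); rewrite gmulfR.
  by apply: lcs_comm; apply/set_mem.
(* Such an [f] kills gamma_5, so a relation between the classes of A and B carries over to their
   images. *)
have fF m (f : gmorphism GK1 (aff (tring m))) u :
    (forall x, [set ga; gb] x ->
       exists r, (val (f x)).1 = (1 + (m.+2)%:R * r)%R) ->
    F u = 1 -> zpow (f A) u.1 * zpow (f B) u.2 = 1.
  move=> flin Fu1.
  have [|g gE] := @restrict_lift _ _ (lcs GK1 4) (lcs GK1 5) f.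
    exact: (tring_lcs5 GK1_generates flin).
  have [gA gB] : g (qL sA) = f A /\ g (qL sB) = f B by split; apply: gE.
  by have := congr1 g Fu1; rewrite FE gmulfM !(gmulf_zpow g) gA gB gmulf1.
apply: (bij_isomorphic (f := F)) => [u Fu|u].
  have u1 : u.1 = 0%R.
    have [_ [f [fga fgb]]] := GK1_aff `|u.1|%N.
    have := fF _ f u; rewrite !gmulfR fga fgb comm_dilation_transl.
    rewrite !comm_transl_dilation !comm_transl_transl zpow1g mulg1 => f1.
    apply: zpow_transl_tring.
    rewrite -[RHS]f1 //; first by congr (zpow (transl _) _); ring.
    move=> _ [] ->; rewrite ?fga ?fgb;
      by [apply: dilation_lin|apply: transl_lin].
  have u2 : u.2 = 0%R.
    have [[f [fga fgb]] _] := GK1_aff `|u.2|%N.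
    have := fF _ f u; rewrite !gmulfR fga fgb comm_transl_dilation.
    rewrite !comm_transl_dilation !comm_transl_transl zpow1g mul1g => f1.
    apply: zpow_transl_tring.
    rewrite -[RHS]f1 //; first by congr (zpow (transl _) _); ring.
    move=> _ [] ->; rewrite ?fga ?fgb;
      by [apply: transl_lin|apply: dilation_lin].
  by rewrite [u]surjective_pairing u1 u2.
(* The preimage in gamma_4 of the image of [F]; it contains gamma_5, A and B. *)
pose P x := exists n (s : sgtype (lcs GK1 4)), val s = x /\ qL s = F n.
have P1 : P 1 by exists 1, 1; rewrite !gmulf1.
have PF x z : P x -> P z -> P (x / z).
  move=> [n [s [<- sE]]] [k [t [<- tE]]]; exists (n / k), (s / t).
  by rewrite !gmulfF sE tE.
have [_ g4] := lcs_gens4_rel GK1_generates GK1_rel.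
have [x xE] := qproj_surj u.
have [|||n [s [sx sE]]] := g4 (mksubgroup P1 PF) _ _ (val x).
- move=> z Gz; exists 1, (exist _ z (mem_set (lcs_sub Gz))); split=> //.
  by rewrite gmulf1; apply/qproj_eq1.
- move=> _ [] ->.
    exists (1%R, 0%R), sA; split=> //.
    by rewrite FE /= mulg1.
  exists (0%R, 1%R), sB; split=> //.
  by rewrite FE /= mul1g.
- exact: (set_mem (valP x)).
by exists n; rewrite -sE -xE; congr (qproj _); apply: val_inj.
Qed.

(** * Values modulo 2 on gamma_4 of the free group *)

Section Parity.
Import GRing.Theory.

(** The translation by 8 on Z / 16, an involution. *)
Definition inv8 : aff (tring 0) := transl ((2%:R : tring 0) ^+ 3)%R.

Lemma inv8X k : inv8 ^+ k = inv8 ^+ odd k.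
Proof.
have inv8K : inv8 * inv8 = 1.
  by rewrite -translD; congr transl; apply/eqP.
rewrite -[in LHS](odd_double_half k) expgnDr -muln2 mulnC expgnA expg2.
by rewrite inv8K expg1n mulg1.
Qed.

Lemma inv8_inj : injective (fun b : bool => inv8 ^+ b).
Proof.
have /eqP inv8_neq1 : inv8 != 1.
  by apply/eqP => /transl_eq1/eqP.
by case=> [] [] //= => [/inv8_neq1|/esym/inv8_neq1].
Qed.

Lemma inv8M (b c : bool) : inv8 ^+ b * inv8 ^+ c = inv8 ^+ (b (+) c).
Proof. by rewrite -expgnDr [LHS]inv8X oddD !oddb. Qed.

Lemma inv8_zpow (b : bool) n : zpow (inv8 ^+ b) n = inv8 ^+ (b && odd `|n|).
Proof.
have V (c : bool) : (inv8 ^+ c)^-1 = inv8 ^+ c.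
  by apply: mulg1_eq; rewrite inv8M addbb.
have X k : (inv8 ^+ b) ^+ k = inv8 ^+ (b && odd k).
  by rewrite -expgnA [LHS]inv8X oddM oddb.
by case: n => k; rewrite /zpow X ?V.
Qed.

(** By freeness any two affine maps with linear parts 1 modulo 2 serve as images. On gamma_4 the
    result amounts to a morphism to Z / 2, recorded as an exponent of [inv8]. *)
Lemma F2_aff (u v : aff (tring 0)) :
  (exists r, (val u).1 = (1 + 2%:R * r)%R) ->
  (exists r, (val v).1 = (1 + 2%:R * r)%R) ->
  exists g : gmorphism (quot (lcs (Free 'I_2) 5)) (aff (tring 0)),
    [/\ g (qproj _ fa) = u, g (qproj _ fb) = v &
        forall w, sgset (lcs _ 4) w -> exists b : bool, g w = inv8 ^+ b].
Proof.
move=> ulin vlin; have [f [fu fv]] := F2_lift u v.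
have flin x : [set fa; fb] x -> exists r, (val (f x)).1 = (1 + 2%:R * r)%R.
  by move=> [] ->; rewrite ?fu ?fv.
have [|g gE] := @quot_lift _ _ f (lcs (Free 'I_2) 5).
  exact: tring_lcs5 F2_generates flin.
exists g; split; rewrite ?gE // => w /lcs_quot[x Fx <-].
have [r] := tring_lcs4 F2_generates flin Fx; rewrite gE => ->.
exists (odd (val r)); rewrite -inv8X -[LHS]/(transl (_ *~ Posz 1)).
have -> : inv8 ^+ val r = zpow inv8 (Posz (val r)) by [].
rewrite zpow_transl; congr transl.
by rewrite -[r in LHS](natr_Zp (r : 'I_(Zp_trunc (2 ^ 4)).+2)) mulr_natr.
Qed.

End Parity.

(** An isomorphism would make gamma_4 of the free quotient generated by the two images A and B,
    whereas three morphisms to Z / 2 are independent on it. *)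
Lemma GK1_quot5 : ~ isomorphic (quot (lcs GK1 5)) (quot (lcs (Free 'I_2) 5)).
Proof.
case=> phi0 [phi' phi'K phiK].
set Q := quot (lcs (Free 'I_2) 5) in phi0 phi' phi'K phiK *.
pose phi : gmorphism _ Q := gmorph (@gmulfM _ _ phi0).
pose psi := gcomp phi (qmorph (lcs GK1 5)).
have psi_surj w : exists x, psi x = w.
  have [x xE] := qproj_surj (phi' w); exists x.
  by rewrite /psi /= xE phiK.
pose A := psi [~ ga, gb, ga, ga]; pose B := psi [~ ga, gb, gb, gb].
have QA : sgset (lcs Q 4) A by apply: lcs_morph; do 3!apply: lcs_comm.
have QB : sgset (lcs Q 4) B by apply: lcs_morph; do 3!apply: lcs_comm.
have Q5 (w : Q) : sgset (lcs Q 5) w -> w = 1.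
  by move=> /lcs_quot[x Fx <-]; apply/qproj_eq1.
have AB : commute A B by apply/commgP/eqP; apply: Q5; apply: lcs_comm.
have [F FE] := zpow_pair AB.
have cover w : sgset (lcs Q 4) w -> exists n, w = F n.
  move=> /(lcs_surj psi_surj)[x Gx <-].
  pose P x := exists n, psi x = F n.
  have P1 : P 1 by exists 1; rewrite !gmulf1.
  have PF u v : P u -> P v -> P (u / v).
    by move=> [n uE] [k vE]; exists (n / k); rewrite !gmulfF uE vE.
  have [_ g4] := lcs_gens4_rel GK1_generates GK1_rel.
  apply: (g4 (mksubgroup P1 PF)) => // [z Gz|_ [] ->].
  - by exists 1; rewrite gmulf1; apply: Q5; apply: lcs_morph.
  - by exists (1%R, 0%R); rewrite FE /= mulg1.
  - by exists (0%R, 1%R); rewrite FE /= mul1g.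
pose qF := qmorph (lcs (Free 'I_2) 5).
pose a := qF fa; pose b := qF fb.
have [n1 E1] : exists n, [~ a, b, b, b] = F n.
  by apply: cover; do 3!apply: lcs_comm.
have [n2 E2] : exists n, [~ a, b, a, a] = F n.
  by apply: cover; do 3!apply: lcs_comm.
have [n3 E3] : exists n, [~ a, b, a, b] = F n.
  by apply: cover; do 3!apply: lcs_comm.
(* The three values of [g] are the combination, with coefficients r = [g A] and s = [g B] modulo 2,
   of the two parity vectors of the exponents in [n1], [n2], [n3]. *)
have val_g (g : gmorphism Q (aff (tring 0))) u v
    (gP : [/\ g a = u, g b = v &
       forall w, sgset (lcs _ 4) w -> exists c : bool, g w = inv8 ^+ c])
    (e1 e2 e3 : bool) :
    [~ u, v, v, v] = inv8 ^+ e1 -> [~ u, v, u, u] = inv8 ^+ e2 ->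
    [~ u, v, u, v] = inv8 ^+ e3 ->
  exists r s, [/\ e1 = (r && odd `|n1.1|) (+) (s && odd `|n1.2|),
     e2 = (r && odd `|n2.1|) (+) (s && odd `|n2.2|) &
     e3 = (r && odd `|n3.1|) (+) (s && odd `|n3.2|)].
  case: gP => ga_u gb_v g4 h1 h2 h3.
  have [[r gA] [s gB]] := (g4 A QA, g4 B QB); exists r, s.
  have gF n : g (F n) = inv8 ^+ ((r && odd `|n.1|) (+) (s && odd `|n.2|)).
    by rewrite FE gmulfM !(gmulf_zpow g) gA gB !inv8_zpow inv8M.
  by split; apply: inv8_inj; rewrite -gF -(h1, h2, h3) -(E1, E2, E3)
    !gmulfR ga_u gb_v.
(* On [a, b, b, b], [a, b, a, a], [a, b, a, b] these take the values (1, 0, 0), (0, 1, 0) and (1, 1,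
   1). *)
have [g1 /val_g h1] := F2_aff (transl_lin 1%R) (dilation_lin 0%R).
have [g2 /val_g h2] := F2_aff (dilation_lin 0%R) (transl_lin (- 1)%R).
have [g3 /val_g h3] := F2_aff (dilation_lin 0%R) (dilation_lin (- 1)%R).
have [||| r1 [s1 [h11 h12 h13]]] := h1 true false false.
- by rewrite !comm_transl_dilation; congr transl; ring.
- by rewrite comm_transl_dilation !comm_transl_transl.
- by rewrite comm_transl_dilation comm_transl_transl comm1g.
have [||| r2 [s2 [h21 h22 h23]]] := h2 false true false.
- by rewrite comm_dilation_transl !comm_transl_transl.
- by rewrite comm_dilation_transl !comm_transl_dilation; congr transl; ring.
- by rewrite comm_dilation_transl comm_transl_dilation comm_transl_transl.
have [||| r3 [s3 [h31 h32 h33]]] := h3 true true true.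
1-3: by rewrite comm_dilation_dilation !comm_transl_dilation; congr transl;
  ring.
(* Three independent vectors of F_2^3 would lie in the span of two parity vectors; all cases are
   enumerated. *)
move: h11 h12 h13 h21 h22 h23 h31 h32 h33.
do 6!case: (odd _); rewrite ?andbF ?andbT ?addbF //=.
all: by case: r1 s1 r2 s2 r3 s3 => [] [] [] [] [] [].
Qed.

Theorem theorem4p1 :
  [/\ isomorphic (quot (lcs GK1 4)) (quot (lcs (Free 'I_2) 4)),
      isomorphic (lcs_factor GK1 4 5) (Algebra.to_multiplicative (int * int)%type)
    & ~ isomorphic (quot (lcs GK1 5)) (quot (lcs (Free 'I_2) 5))]
  /\
  exists N : nsubgroup GK1,
    isomorphic (sgtype N) (Free 'I_3) /\
    isomorphic (quot N) (Algebra.to_multiplicative int).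
Proof.
split; last exact: GK1_semidirect.
by split; [apply: GK1_quot4|apply: GK1_lcs_factor|apply: GK1_quot5].
Qed.
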